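(* Let $D_1^\pm$ be the holomorphic ($+$) or antiholomorphic ($-$) discrete series representation of $\mathrm{PSL}(2,\mathbb{R})$ with parameter $n=1$, and $\pi$ the derived representation of $\mathfrak{sl}(2,\mathbb{R})$ on $C^\infty(D_1^\pm)$. Let $\mathfrak{an}$ act on itself by the adjoint representation $\mathrm{ad}$, and let $d$ be the differential of the Chevalley--Eilenberg complex $C^*(\mathfrak{an};C^\infty(D_1^\pm)\otimes\mathfrak{an})=\bigwedge^*\mathfrak{an}^*\otimes C^\infty(D_1^\pm)\otimes\mathfrak{an}$. Let $\varphi\colon C^\infty(D_1^\pm)\to\mathbb{C}$ be a linear map with $\ker\varphi=\pi(E)C^\infty(D_1^\pm)$ and $\pi(H)\varphi=-\frac{1}{\sqrt2}\varphi$, let $h\in(D_1^\pm)_{(\pm1)}$ with $\varphi(h)=1$, and put $S=\pi(E)^{-1}(\pi(H)-\frac{1}{\sqrt2})$, $T=\pi(E)^{-1}(\mathrm{id}-\varphi h)$. Define operators $\delta$ and $p$ on this complex by \begin{align*} \delta&=2d_\star^\top\otimes T\otimes\mathrm{ad}(E)+2\iota(H)\otimes\mathrm{id}\otimes\mathrm{ad}(H)-2\iota(E)\otimes S\otimes\mathrm{ad}(H)\\ &\quad+\iota(E)\otimes T\otimes(\mathrm{id}-\sqrt2\,\mathrm{ad}(H))+\sqrt2\,\iota(E)\otimes ST\otimes\mathrm{ad}(E),\\ p&=\varepsilon\bigl(\theta_E\pm\sqrt2i\theta_H\bigr)\iota(E)\otimes\varphi h\otimes\bigl(\mathrm{id}-\sqrt2\,\mathrm{ad}(H)\pm2i\,\mathrm{ad}(E)\bigr)\\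 &\quad+\varepsilon(\theta_H)\varepsilon(\theta_E)\iota(H)\iota(E)\otimes\varphi h\otimes(\pm2i\,\mathrm{ad}(E)). \end{align*} Then \begin{align*} C^*(\mathfrak{an};C^\infty(D_1^\pm)\otimes\mathfrak{an})&=\operatorname{im}p\oplus\operatorname{im}d\oplus\operatorname{im}\delta,\\ \ker d&=\operatorname{im}p\oplus\operatorname{im}d,\\ \ker\delta&=\operatorname{im}p\oplus\operatorname{im}\delta,\\ \ker d\cap\ker\delta&=\operatorname{im}p,\\ \operatorname{im}d\oplus\operatorname{im}\delta&=\ker p. \end{align*} An element $x$ of the complex is decomposed as $x=p(x)+d\delta x+\delta dx$ with respect to the first decomposition, and the second decomposition implies $$H^*(\mathfrak{an};C^\infty(D_1^\pm)\otimes\mathfrak{an})\simeq\operatorname{im}p.$$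
   Context: $H=\frac{1}{2\sqrt{2}}\begin{pmatrix}1&0\\0&-1\end{pmatrix}$, $E=\frac12\begin{pmatrix}0&1\\0&0\end{pmatrix}$, $[H,E]=\frac1{\sqrt2}E$, $\mathfrak{an}=\mathbb{R}H\oplus\mathbb{R}E\subset\mathfrak{sl}(2,\mathbb{R})$, $\theta_H,\theta_E\in\mathfrak{an}^*$ the basis dual to $H,E$. The complex $C^*(\mathfrak{an};C^\infty(D_1^\pm)\otimes\mathfrak{an})$ is identified with $(\bigwedge^*\mathfrak{an}^*\otimes\mathbb{C})\otimes_\mathbb{C}C^\infty(D_1^\pm)\otimes_\mathbb{C}(\mathfrak{an}\otimes\mathbb{C})$; $\iota(X)$ is the interior product, $\varepsilon(\theta)$ is left exterior multiplication by $\theta$, and tensor products of operators are taken without signs. $d_\star$ is the Chevalley--Eilenberg differential on $\bigwedge^*\mathfrak{an}^*=C^*(\mathfrak{an};\mathbb{R})$ and $d_\star^\top$ its adjoint for the inner product with orthonormal basis $1,\theta_H,\theta_E,\theta_H\wedge\theta_E$. For $k\in\mathbb{Z}$ let $r_k$ be the character of $\mathrm{PSO}(2)$ with $\exp\theta\begin{pmatrix}0&\frac12\\-\frac12&0\end{pmatrix}\mapsto e^{ik\theta}$, and $\mathcal{H}_{(k)}$ the $r_k$-isotypic component of a unitary representation $\mathcal{H}$. $D_1^+$ (resp. $D_1^-$) is the irreducible unitary representation of $\mathrm{PSL}(2,\mathbb{R})$, unique up to equivalence, with $\dim\mathcal{H}_{(k)}=1$ for $k\geq1$ and $0$ for $k<1$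 (resp. $1$ for $k\leq-1$ and $0$ for $k>-1$); these components consist of $C^\infty$ vectors. Known facts: $\pi(E)$ is injective on $C^\infty(D_1^\pm)$, such $\varphi$ exists, and $\varphi\neq0$ on $(D_1^\pm)_{(\pm1)}$. Here $(\pi(X)\varphi)(f)=-\varphi(\pi(X)f)$; $\varphi h$ is the operator $f\mapsto\varphi(f)h$; the images of $\pi(H)-\frac1{\sqrt2}$ and $\mathrm{id}-\varphi h$ lie in $\ker\varphi=\pi(E)C^\infty(D_1^\pm)$, on which $\pi(E)^{-1}$ is defined. Upper signs are for $D_1^+$, lower signs for $D_1^-$. *)

(* Defs.v *)
From HB Require Import structures.
From mathcomp Require Import all_boot all_order all_algebra.
From mathcomp Require Import all_classical all_reals all_analysis.
From mathcomp Require Import complex.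
Set Implicit Arguments.
Unset Strict Implicit.
Unset Printing Implicit Defensive.
Import Order.TTheory GRing.Theory Num.Theory numFieldNormedType.Exports.
Local Open Scope classical_set_scope.
Local Open Scope ring_scope.
Local Open Scope complex_scope.

(* SL(2,R) and its Lie algebra are realized inside 'M[R]_2. *)
Definition SL2 (R : realType) : set 'M[R]_2 := [set g | \det g = 1].

Definition expmx (R : realType) (X : 'M[R]_2) : 'M[R]_2 :=
  lim (series (fun k => (k`!%:R)^-1 *: X ^+ k) @ \oo).

Definition mx22 (R : realType) (a b c d : R) : 'M[R]_2 :=
  \matrix_(i, j) (if i == 0 then (if j == 0 then a else b)
                  else (if j == 0 then c else d)).

Definition slH (R : realType) : 'M[R]_2 :=
  (2 * Num.sqrt 2)^-1 *: mx22 1 0 0 (-1).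
Definition slE (R : realType) : 'M[R]_2 := 2^-1 *: mx22 0 1 0 0.
Definition soK (R : realType) : 'M[R]_2 := mx22 0 2^-1 (- 2^-1) 0.

Definition brk (R : realType) (X Y : 'M[R]_2) : 'M[R]_2 := X *m Y - Y *m X.

(* Index 0 of 'I_2 stands for H and index 1 for E. *)
Definition iH : 'I_2 := ord0.
Definition iE : 'I_2 := ord_max.

Definition anb (R : realType) (i : 'I_2) : 'M[R]_2 :=
  if i == iH then slH R else slE R.

(* The dual basis theta_H, theta_E; only its restriction to the span of
   H and E is meaningful. *)
Definition theta (R : realType) (i : 'I_2) (X : 'M[R]_2) : R :=
  if i == iH then 2 * Num.sqrt 2 * X 0 0 else 2 * X 0 1.

Lemma theta_anb (R : realType) (i j : 'I_2) :
  theta i (anb R j) = (i == j)%:R.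
Proof.
have s0 : (2 * Num.sqrt 2 : R) != 0 by rewrite mulf_neq0 ?sqrtr_eq0 -?ltNge.
have t0 : (2 : R) != 0 by rewrite pnatr_eq0.
have /orP[/eqP->|/eqP->] : (i == iH) || (i == iE) by case: i => -[|[]].
all: have /orP[/eqP->|/eqP->] : (j == iH) || (j == iE) by case: j => -[|[]].
all: by rewrite /theta /anb /= /slH /slE !mxE /= ?mulr1 ?mulr0 ?mulfV.
Qed.

(* The matrix of ad(X) on an (x) C in the basis H, E (acting on columns). *)
Definition adm (R : realType) (X : 'M[R]_2) : 'M[R[i]]_2 :=
  \matrix_(j, k) (theta j (brk X (anb R k)))%:C.

Record inner_product (R : realType) (V : completeNormedModType R[i])
    (ip : V -> V -> R[i]) : Prop := InnerProduct {
  ip_linear : forall (a : R[i]) (u v w : V),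
    ip (a *: u + v) w = a * ip u w + ip v w ;
  ip_conj : forall u v : V, ip v u = Num.conj (ip u v) ;
  ip_norm : forall v : V, `|v| ^+ 2 = ip v v }.

(* A representation of PSL(2,R) is a representation of SL(2,R) on which -1
   acts trivially; the values of U outside SL2 are irrelevant. *)
Record unitary_rep (R : realType) (V : completeNormedModType R[i])
    (ip : V -> V -> R[i]) (U : 'M[R]_2 -> V -> V) : Prop := UnitaryRep {
  urep_linear : forall g, SL2 g -> forall (a : R[i]) (u v : V),
    U g (a *: u + v) = a *: U g u + U g v ;
  urep1 : forall v : V, U 1 v = v ;
  urepM : forall g g', SL2 g -> SL2 g' -> forall v : V,
    U (g *m g') v = U g (U g' v) ;
  urepN1 : forall v : V, U (- 1) v = v ;
  urep_unitary : forall g, SL2 g -> forall u v : V, ip (U g u) (U g v) = ip u v ;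
  urep_continuous : forall v : V, {within @SL2 R, continuous (fun g => U g v)} }.

Definition irreducible_rep (R : realType) (V : completeNormedModType R[i])
    (U : 'M[R]_2 -> V -> V) : Prop :=
  (exists v : V, v != 0) /\
  forall W : set V,
    closed W -> W 0 ->
    (forall (a : R[i]) (u v : V), W u -> W v -> W (a *: u + v)) ->
    (forall (g : 'M[R]_2) (v : V), SL2 g -> W v -> W (U g v)) ->
    W = [set 0] \/ W = setT.

(* The r_k-isotypic component, r_k (exp (t K)) = e^{ikt}. *)
Definition isotypic (R : realType) (V : completeNormedModType R[i])
    (U : 'M[R]_2 -> V -> V) (k : int) : set V :=
  [set v | forall t : R,
     U (expmx (t *: soK R)) v = (cos (k%:~R * t) +i* sin (k%:~R * t))%C *: v].

Definition line (R : realType) (V : lmodType R[i]) (S : set V) : Prop :=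
  exists2 u : V, u != 0 & S = [set c *: u | c in [set: R[i]]].

(* The sign +1 or -1 attached to D_1^+ (neg = false) or D_1^- (neg = true). *)
Definition sgz_of (neg : bool) : int := (-1) ^+ neg.

Record is_D1 (R : realType) (neg : bool) (V : completeNormedModType R[i])
    (ip : V -> V -> R[i]) (U : 'M[R]_2 -> V -> V) : Prop := IsD1 {
  D1_hilbert : inner_product ip ;
  D1_unitary : unitary_rep ip U ;
  D1_irreducible : irreducible_rep U ;
  D1_types : forall k : int,
    if 1 <= sgz_of neg * k then line (isotypic U k)
    else isotypic U k = [set 0] }.

(* F is of class C^n on the open set O of 'M[R]_2 = R^4: the F' i j are the
   partial derivatives, i.e. the components of the Frechet derivative. *)
Fixpoint Cn_on (R : realType) (V : completeNormedModType R[i]) (n : nat)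
    (O : set 'M[R]_2) (F : 'M[R]_2 -> V) {struct n} : Prop :=
  (forall m, O m -> {for m, continuous F}) /\
  match n with
  | 0%N => True
  | n'.+1 => exists F' : 'I_2 -> 'I_2 -> 'M[R]_2 -> V,
      (forall m, O m -> forall e : R, 0 < e ->
         \forall k \near (0 : 'M[R]_2),
           `|F (m + k) - F m - \sum_i \sum_j (k i j)%:C *: F' i j m|
             <= (e * `|k|)%:C) /\
      (forall i j, Cn_on n' O (F' i j))
  end.

(* Smoothness on the embedded submanifold SL(2,R) of R^4: local existence of
   smooth extensions. *)
Definition smooth_SL2 (R : realType) (V : completeNormedModType R[i])
    (f : 'M[R]_2 -> V) : Prop :=
  forall g, SL2 g -> exists (O : set 'M[R]_2) (F : 'M[R]_2 -> V),
    [/\ open O, O g, (forall m, O m -> SL2 m -> F m = f m) &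
        forall n, Cn_on n O F].

Definition Cinf (R : realType) (V : completeNormedModType R[i])
    (U : 'M[R]_2 -> V -> V) : set V :=
  [set v | smooth_SL2 (fun g => U g v)].

(* pi(X) v = d/dt U(exp tX) v at t = 0; meaningful for v in C^\infty(U). *)
Definition dU (R : realType) (V : completeNormedModType R[i])
    (U : 'M[R]_2 -> V -> V) (X : 'M[R]_2) (v : V) : V :=
  lim ((t^-1)%:C *: (U (expmx (t *: X)) v - v) @[t --> (0 : R)^']).

(* (pi(X) phi)(f) = - phi (pi(X) f) *)
Definition dual_dU (R : realType) (V : completeNormedModType R[i])
    (U : 'M[R]_2 -> V -> V) (X : 'M[R]_2) (phi : V -> R[i]) (f : V) : R[i] :=
  - phi (dU U X f).

(* pi(E)^{-1}: a C^\infty vector w with pi(E) w = v, if there is one (it is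
   then unique in the representations under consideration). *)
Definition piEinv (R : realType) (V : completeNormedModType R[i])
    (U : 'M[R]_2 -> V -> V) (v : V) : V :=
  xget 0 [set w | Cinf U w /\ dU U (slE R) w = v].

Definition opS (R : realType) (V : completeNormedModType R[i])
    (U : 'M[R]_2 -> V -> V) (v : V) : V :=
  piEinv U (dU U (slH R) v - ((Num.sqrt 2)^-1)%:C *: v).

Definition phih (R : realType) (V : completeNormedModType R[i])
    (phi : V -> R[i]) (h : V) (v : V) : V := phi v *: h.

Definition opT (R : realType) (V : completeNormedModType R[i])
    (U : 'M[R]_2 -> V -> V) (phi : V -> R[i]) (h : V) (v : V) : V :=
  piEinv U (v - phih phi h v).

(* Cochains with values in W, in coordinates: w A is the coefficient of
   theta_A, the exterior product of the theta_i, i in A, in increasing order.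
   So w A is also the value of the alternating form w on the basis vectors
   indexed by A. *)
Notation cochain W := {ffun {set 'I_2} -> W}.

(* (-1) to the (0-based) position of i among the elements of A or i |: A *)
Definition possgn (K : pzRingType) (i : 'I_2) (A : {set 'I_2}) : K :=
  (-1) ^+ #|[set j in A | (j < i)%N]|.

Definition intp (R : realType) (W : lmodType R[i]) (X : 'M[R]_2)
    (w : cochain W) : cochain W :=
  [ffun A : {set 'I_2} => \sum_(i | i \notin A)
     ((theta i X)%:C * possgn R[i] i A) *: w (i |: A)].

(* The Chevalley-Eilenberg differential
     (dw)(X_0,...,X_n) = \sum_i (-1)^i X_i w(..., ^X_i, ...)
       + \sum_(i < j) (-1)^(i+j) w([X_i, X_j], ..., ^X_i, ..., ^X_j, ...)
   evaluated on the basis vectors indexed by A. *)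
Definition ceD (R : realType) (W : lmodType R[i])
    (act : 'M[R]_2 -> W -> W) (w : cochain W) : cochain W :=
  [ffun A : {set 'I_2} =>
     \sum_(a in A) possgn R[i] a A *: act (anb R a) (w (A :\ a))
     + \sum_(a in A) \sum_(b in A | (a < b)%N)
         (possgn R[i] a A * possgn R[i] b A) *:
           intp (brk (anb R a) (anb R b)) w (A :\ a :\ b)].

(* Lam R = (exterior algebra of an^* ) (x) C *)
Notation Lam R := (cochain R[i]^o).

Definition thetaA (R : realType) (A : {set 'I_2}) : Lam R :=
  [ffun B : {set 'I_2} => ((B == A)%:R : R[i])].

(* epsilon(c) for the covector c = \sum_i c i * theta_i *)
Definition extm (R : realType) (c : 'I_2 -> R[i]) (w : Lam R) : Lam R :=
  [ffun A : {set 'I_2} =>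
     \sum_(i in A) c i * possgn R[i] i A * (w (A :\ i) : R[i])].

Definition cov (R : realType) (i : 'I_2) : 'I_2 -> R[i] :=
  fun j => (j == i)%:R.

Definition dstar (R : realType) : Lam R -> Lam R :=
  @ceD R (R[i]^o : lmodType R[i]) (fun _ _ => 0).

(* The adjoint of dstar for the orthonormal basis theta_A (dstar has real
   coefficients), i.e. the transposed operator. *)
Definition dstarT (R : realType) (w : Lam R) : Lam R :=
  [ffun A : {set 'I_2} =>
     \sum_(B : {set 'I_2}) (dstar (thetaA R A) B * w B : R[i])].

(* (x A) j is the coefficient in V of theta_A (x) e_j, e_0 = H, e_1 = E. *)
Notation coeff V := {ffun 'I_2 -> V}.

Notation tcochain V := (cochain (coeff V)).

Definition complex_an (R : realType) (V : completeNormedModType R[i])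
    (U : 'M[R]_2 -> V -> V) : set (tcochain V) :=
  [set x : tcochain V | forall A j, Cinf U (x A j)].

Definition homog (V : nmodType) (n : nat) (x : tcochain V) : Prop :=
  forall A : {set 'I_2}, #|A| != n -> x A = 0.

(* The action pi(X) (x) id + id (x) ad(X) on C^\infty(U) (x) an *)
Definition actW (R : realType) (V : completeNormedModType R[i])
    (U : 'M[R]_2 -> V -> V) (X : 'M[R]_2) (w : coeff V) : coeff V :=
  [ffun j : 'I_2 => dU U X (w j) + \sum_(k < 2) adm X j k *: w k].

Definition dan (R : realType) (V : completeNormedModType R[i])
    (U : 'M[R]_2 -> V -> V) : tcochain V -> tcochain V :=
  @ceD R (coeff V) (actW U).

(* The operator a (x) f (x) m, without signs *)
Definition tens (R : realType) (V : completeNormedModType R[i])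
    (a : Lam R -> Lam R) (f : V -> V) (m : 'M[R[i]]_2)
    (x : tcochain V) : tcochain V :=
  [ffun A : {set 'I_2} => [ffun j : 'I_2 =>
     \sum_(B : {set 'I_2}) \sum_(k < 2)
       ((a (thetaA R B) A : R[i]) * m j k) *: f (x B k)] : coeff V].

Definition sqrt2C (R : realType) : R[i] := (Num.sqrt 2 : R)%:C.

Definition iLam (R : realType) (X : 'M[R]_2) : Lam R -> Lam R :=
  @intp R (R[i]^o : lmodType R[i]) X.

Definition delta_op (R : realType) (V : completeNormedModType R[i])
    (U : 'M[R]_2 -> V -> V) (phi : V -> R[i]) (h : V)
    (x : tcochain V) : tcochain V :=
  let H := slH R in
  let E := slE R in
  let S := opS U in
  let T := opT U phi h in
  (2 : R[i]) *: tens (@dstarT R) T (adm E) x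
  + (2 : R[i]) *: tens (iLam H) id (adm H) x
  - (2 : R[i]) *: tens (iLam E) S (adm H) x
  + tens (iLam E) T (1%:M - sqrt2C R *: adm H) x
  + sqrt2C R *: tens (iLam E) (S \o T) (adm E) x.

Definition p_op (R : realType) (neg : bool) (V : completeNormedModType R[i])
    (phi : V -> R[i]) (h : V) (x : tcochain V) : tcochain V :=
  let H := slH R in
  let E := slE R in
  let s : R[i] := (sgz_of neg)%:~R in
  let I : R[i] := (0 +i* 1)%C in
  let c : 'I_2 -> R[i] :=
    fun j => cov R iE j + s * sqrt2C R * I * cov R iH j in
  tens (extm c \o iLam E) (phih phi h)
       (1%:M - sqrt2C R *: adm H + (s * 2 * I) *: adm E) x
  + tens (extm (cov R iH) \o extm (cov R iE) \o iLam H \o iLam E)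
         (phih phi h) ((s * 2 * I) *: adm E) x.

Definition ker_on (M : zmodType) (C : set M) (f : M -> M) : set M :=
  [set x | C x /\ f x = 0].

Definition dsum2 (M : zmodType) (S A B : set M) : Prop :=
  S = [set x | exists a b, [/\ A a, B b & x = a + b]] /\
  forall a b a' b', A a -> B b -> A a' -> B b' ->
    a + b = a' + b' -> a = a' /\ b = b'.

Definition dsum3 (M : zmodType) (S A B D : set M) : Prop :=
  S = [set x | exists a b c, [/\ A a, B b, D c & x = a + b + c]] /\
  forall a b c a' b' c', A a -> B b -> D c -> A a' -> B b' -> D c' ->
    a + b + c = a' + b' + c' -> [/\ a = a', b = b' & c = c'].

Definition coset_add (M : zmodType) (B : set M) (x : M) : set M :=
  [set x + b | b in B].

Definition quot (M : zmodType) (Z B : set M) : set (set M) :=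
  [set coset_add B x | x in Z].

Definition quot_iso (R : realType) (V : completeNormedModType R[i])
    (Z B P : set (tcochain V)) : Prop :=
  exists f : set (tcochain V) -> tcochain V,
    [/\ set_bij (quot Z B) P f,
        (forall (a : R[i]) (x y : tcochain V), Z x -> Z y ->
           f (coset_add B (a *: x + y))
             = a *: f (coset_add B x) + f (coset_add B y)) &
        (forall n (x : tcochain V), Z x -> homog n x ->
           homog n (f (coset_add B x)))].

(* Main.v *)
Require Import Defs.
From HB Require Import structures.
From mathcomp Require Import all_boot all_order all_algebra.
From mathcomp Require Import all_classical all_reals all_analysis.
From mathcomp Require Import complex ring.
Import Order.TTheory GRing.Theory Num.Theory numFieldNormedType.Exports.
Local Open Scope classical_set_scope.
Local Open Scope ring_scope.
Local Open Scope complex_scope.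
Set Implicit Arguments.
Unset Strict Implicit.
Unset Printing Implicit Defensive.

(** Everything rests on one identity, x = p x + d (delta x) + delta (d x),
    together with d^2 = delta^2 = 0 and the vanishing of d p, p d, delta p and
    p delta.  A homotopy of this kind makes p, d delta and delta d commuting
    projections onto the three images, and the five decompositions and the
    description of the cohomology are formal consequences ([dsum_complex] to
    [harmonic_part_bij]).

    A cochain has eight coordinates in C^\infty(D_1^\pm), the coefficients of
    1, theta_H, theta_E and theta_H theta_E tensored with H and E.  In these
    coordinates ([dan_coord], [delta_coord], [p_coord]) all the identities
    become linear relations between words in pi(H), pi(E), S and T.  They are
    settled by applying pi(E), which is injective: from E S = H - 1/sqrt 2,
    E T = 1 - phi h and [H, E] = E / sqrt 2 one gets S E = H, T E = 1 and the
    rules that move H to the right of S and T ([HS], [HT]).  The representation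
    enters through four facts, collected in [an_splitting].

    - Smooth vectors are stable under pi(H) and pi(E), which act linearly
      ([Cinf_dU], [dU_comb]): the orbit map g |-> U g (pi(X) v) is a derivative
      of the orbit map of v along a left-invariant vector field.

    - The bracket relation ([dU_bracket]) is obtained in weak form from
      exp(tH) exp(sE) = exp(s e^(t/sqrt 2) E) exp(tH) and from the skewness of
      pi(H) and pi(E); testing it against a smooth vector that is the difference
      of its two sides gives the relation itself.

    - pi(E) is injective ([dU_slE_inj]) by the Mautner phenomenon: a vector
      killed by pi(E) is fixed by the upper unipotent group, hence by all of
      SL(2,R), hence has K-type 0, and D_1^\pm has no such K-type.

    - pi(H) h = h / sqrt 2 \pm sqrt 2 i pi(E) h ([dU_lowest]), because moving
      the extreme K-type of h towards 0 leads to the absent K-type 0.  This is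
      S h = \pm sqrt 2 i h, and it explains the constants in p. *)

(** * Real-valued norms and limits *)

Section RealNorm.
Variables (R : realType) (V : completeNormedModType R[i]).
Implicit Types (u v : V) (a : R[i]) (t : R).

(** The norm of V is R[i]-valued; its real part allows estimates in the
    totally ordered field R. *)
Definition nrm v : R := complex.Re `|v|.

Lemma normE v : `|v| = (nrm v)%:C.
Proof. by rewrite /nrm RRe_real // normr_real. Qed.

Lemma realC_inj : injective (@real_complex R).
Proof. exact: (@complexI R). Qed.

Lemma nrm_ge0 v : 0 <= nrm v.
Proof. by rewrite -lecR -normE normr_ge0. Qed.

Lemma nrm0 : nrm 0 = 0.
Proof. by apply: realC_inj; rewrite -normE normr0. Qed.

Lemma nrm_eq0 v : nrm v = 0 -> v = 0.
Proof. by move=> v0; apply/eqP; rewrite -normr_eq0 normE v0. Qed.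

Lemma nrmD u v : nrm (u + v) <= nrm u + nrm v.
Proof. by rewrite -lecR raddfD /= -!normE ler_normD. Qed.

Lemma nrmZ a v : nrm (a *: v) = complex.Re `|a| * nrm v.
Proof.
apply: realC_inj; rewrite -normE normrZ rmorphM /= -normE; congr (_ * _).
Qed.

Lemma normc_real t : `|t%:C| = `|t|%:C :> R[i].
Proof. by rewrite normc_def /= expr0n /= addr0 sqrtr_sqr. Qed.

Lemma nrmZr t v : nrm (t%:C *: v) = `|t| * nrm v.
Proof. by rewrite nrmZ normc_real. Qed.

Lemma cvg_nrmP {T : Type} {F : set_system T} {FF : Filter F} (f : T -> V) v :
  f x @[x --> F] --> v <-> nrm (f x - v) @[x --> F] --> (0 : R).
Proof.
split=> [/cvgrPdist_lt cf|/cvgr0Pnorm_lt cf].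
  apply/cvgr0Pnorm_lt => e e0.
  have := cf e%:C; rewrite ltcR => /(_ e0); apply: filterS => x.
  by rewrite distrC normE ltcR ger0_norm ?nrm_ge0.
apply/cvgrPdist_lt => e e0.
have eE : e = (complex.Re e)%:C by rewrite RRe_real // gtr0_real.
have := cf (complex.Re e); rewrite -ltcR -eE => /(_ e0); apply: filterS => x.
by rewrite distrC normE eE ltcR ger0_norm ?nrm_ge0.
Qed.

Lemma cvg_realC {T : Type} {F : set_system T} {FF : Filter F} (f : T -> R) t :
  f x @[x --> F] --> t -> ((f x)%:C : R[i]^o) @[x --> F] --> (t%:C : R[i]^o).
Proof.
move=> /cvgrPdist_lt cf; apply/cvgrPdist_lt => e e0.
have eE : e = (complex.Re e)%:C by rewrite RRe_real // gtr0_real.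
have := cf (complex.Re e); rewrite -ltcR -eE => /(_ e0); apply: filterS => x.
by rewrite -rmorphB normc_real eE ltcR.
Qed.

Lemma cvg_complexP {T : Type} {F : set_system T} {FF : Filter F}
    (f : T -> R[i]) (l : R[i]) :
  complex.Re (f x) @[x --> F] --> complex.Re l ->
  complex.Im (f x) @[x --> F] --> complex.Im l ->
  (f x : R[i]^o) @[x --> F] --> (l : R[i]^o).
Proof.
move=> cr ci.
have -> : f = fun x => (complex.Re (f x))%:C + (complex.Im (f x))%:C * 'i%C.
  by apply/funext => x; case: (f x) => a b; simpc.
have -> : l = (complex.Re l)%:C + (complex.Im l)%:C * 'i%C.
  by case: l {cr ci} => a b; simpc.
apply: cvgD; first exact: cvg_realC.
by apply: cvgMr_tmp; exact: cvg_realC.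
Qed.

End RealNorm.

Section MatrixLimits.
Variables (R : realType).
Implicit Types (M N : 'M[R]_2).

Lemma mx_coord_le M i j : `|M i j| <= `|M|.
Proof.
rewrite /Num.norm /= mx_normrE.
by apply: (le_bigmax_cond _ (fun ij : 'I_2 * 'I_2 => `|M ij.1 ij.2|) (j := (i, j))).
Qed.

Lemma cvg_mxP {T : Type} {F : set_system T} {FF : Filter F} (f : T -> 'M[R]_2) M :
  (forall i j, f x i j @[x --> F] --> M i j) -> f x @[x --> F] --> M.
Proof.
move=> cf; apply/cvgrPdist_lt => e e0.
have : \forall x \near F, forall ij : 'I_2 * 'I_2, `|M ij.1 ij.2 - f x ij.1 ij.2| < e.
  apply: filter_forall => -[i j] /=.
  by have /cvgrPdist_lt/(_ _ e0) := cf i j.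
apply: filterS => x H; rewrite /Num.norm /= mx_normrE.
by apply/bigmax_ltP; split=> // -[i j] _; rewrite !mxE; exact: (H (i, j)).
Qed.

Lemma cvg_mx_coord {T : Type} {F : set_system T} {FF : Filter F} (f : T -> 'M[R]_2) M i j :
  f x @[x --> F] --> M -> f x i j @[x --> F] --> M i j.
Proof. by move=> cf; apply: (@cvg_comp _ _ _ f (fun N : 'M[R]_2 => N i j) _ _ _ cf); exact: coord_continuous. Qed.

End MatrixLimits.

(** * Frechet derivatives and curves *)

Section Calculus.
Variables (R : realType) (V : completeNormedModType R[i]).
Implicit Types (O : set 'M[R]_2) (F G : 'M[R]_2 -> V) (m k X : 'M[R]_2)
  (D : 'I_2 -> 'I_2 -> V).

(** The Frechet derivative with partial derivatives D, in the direction X. *)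
Definition lin D X : V := \sum_i \sum_j (X i j)%:C *: D i j.

Definition frechet F m D : Prop := forall e : R, 0 < e ->
  \forall k \near (0 : 'M[R]_2), nrm (F (m + k) - F m - lin D k) <= e * `|k|.

Definition tangent (g : R -> 'M[R]_2) m X : Prop :=
  t^-1 *: (g t - m) @[t --> 0^'] --> X.

Lemma linD D X k : lin D (X + k) = lin D X + lin D k.
Proof.
rewrite /lin -big_split; apply: eq_bigr => i _; rewrite -big_split /=.
by apply: eq_bigr => j _; rewrite mxE raddfD /= scalerDl.
Qed.

Lemma linZ D (t : R) X : lin D (t *: X) = t%:C *: lin D X.
Proof.
rewrite /lin scaler_sumr; apply: eq_bigr => i _; rewrite scaler_sumr.
by apply: eq_bigr => j _; rewrite mxE rmorphM scalerA.
Qed.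

Lemma linN D X : lin D (- X) = - lin D X.
Proof. by rewrite -scaleN1r linZ rmorphN1 scaleN1r. Qed.

Lemma linB D X k : lin D (X - k) = lin D X - lin D k.
Proof. by rewrite linD linN. Qed.

Lemma lin_delta D i j : lin D (delta_mx i j) = D i j.
Proof.
rewrite /lin (bigD1 i) //= (bigD1 j) //= big1 ?addr0 => [|j' jj']; last first.
  by rewrite mxE (negPf jj') andbF scale0r.
rewrite big1 ?addr0 => [|i' ii']; first by rewrite mxE !eqxx scale1r.
by rewrite big1 // => j' _; rewrite mxE (negPf ii') scale0r.
Qed.

Lemma cvg_lin {T : Type} {F : set_system T} {FF : Filter F} D (f : T -> 'M[R]_2) X :
  f x @[x --> F] --> X -> lin D (f x) @[x --> F] --> lin D X.
Proof.
move=> cf; do 2!(apply: cvg_big => [|? _]; first exact: add_continuous).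
apply: cvgZr_tmp.
by apply: cvg_realC; exact: cvg_mx_coord.
Qed.

Lemma tangent_cvg (g : R -> 'M[R]_2) m X : tangent g m X -> g t @[t --> 0^'] --> m.
Proof.
move=> tg; apply/subr_cvg0 => /=.
have : (t *: (t^-1 *: (g t - m))) @[t --> (0:R)^'] --> (0 : R) *: X.
  by apply: cvgZ => //; exact: nbhs_dnbhs.
rewrite scale0r; apply: cvg_trans; apply: near_eq_cvg.
near=> t.
rewrite scalerA divff ?scale1r //.
by near: t; exact: nbhs_dnbhs_neq.
Unshelve. all: by end_near. Qed.

(** The chain rule along a curve: g t - m is O(t), so the Frechet remainder,
    divided by t, tends to 0. *)
Lemma frechet_tangent F m D (g : R -> 'M[R]_2) X :
  frechet F m D -> tangent g m X ->
  (t^-1)%:C *: (F (g t) - F m) @[t --> 0^'] --> lin D X.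
Proof.
move=> dF tg; apply/cvg_nrmP/cvgr0Pnorm_le => e e0.
have cl : lin D (t^-1 *: (g t - m)) @[t --> 0^'] --> lin D X by exact: cvg_lin.
have /cvg_nrmP/cvgr0Pnorm_le/(_ (e / 2)) {}cl := cl.
pose c := e / 2 / (`|X| + 1).
have c0 : 0 < c by rewrite !divr_gt0 // ltr_wpDl.
have := dF _ c0 => /nbhs_ballP[d /= d0 dB].
have cg0 : (g t - m) @[t --> (0 : R)^'] --> (0 : 'M[R]_2).
  by rewrite -(subrr m); apply: cvgB; [exact: (tangent_cvg tg)|exact: cvg_cst].
near=> t.
have t0 : t != 0 by near: t; exact: nbhs_dnbhs_neq.
have n1 : `|nrm (lin D (t^-1 *: (g t - m)) - lin D X)| <= e / 2.
  by near: t; apply: cl; rewrite divr_gt0.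
have n2 : nrm (F (g t) - F m - lin D (g t - m)) <= c * `|g t - m|.
  move: (dB (g t - m)) => /=; rewrite [m + _]addrC subrK; apply.
  rewrite -ball_normE /= sub0r normrN.
  by near: t; move/cvgr0Pnorm_lt: cg0; apply.
have n3 : `|t^-1 *: (g t - m)| <= `|X| + 1.
  have : `|X - t^-1 *: (g t - m)| <= 1 by near: t; move/cvgrPdist_le: tg; apply.
  move=> h; rewrite -[t^-1 *: _](subrK X) (le_trans (ler_normD _ _)) //.
  by rewrite addrC lerD2l distrC.
rewrite ger0_norm ?nrm_ge0 //.
have -> : t^-1%:C *: (F (g t) - F m) - lin D X =
    t^-1%:C *: (F (g t) - F m - lin D (g t - m)) + (lin D (t^-1 *: (g t - m)) - lin D X).
  by rewrite linZ [in RHS]scalerBr addrA subrK.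
rewrite (le_trans (nrmD _ _)) // [leRHS](splitr e) lerD //; last first.
  by rewrite (le_trans (ler_norm _)).
rewrite nrmZr (le_trans (ler_wpM2l _ n2)) // mulrCA.
have -> : `|t^-1| * `|g t - m| = `|t^-1 *: (g t - m)| by rewrite normrZ.
by rewrite (le_trans (ler_wpM2l (ltW c0) n3)) // /c divfK // gt_eqF // ltr_wpDl.
Unshelve. all: by end_near. Qed.

Lemma tangent_line m X : tangent (fun t => m + t *: X) m X.
Proof.
have : X @[_ --> (0 : R)^'] --> X by exact: cvg_cst.
apply: cvg_trans; apply: near_eq_cvg; near=> t.
rewrite addrAC subrr add0r scalerA mulVf ?scale1r //.
by near: t; exact: nbhs_dnbhs_neq.
Unshelve. all: by end_near. Qed.

(** Straight lines in the coordinate directions recover the partial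
    derivatives. *)
Lemma frechet_unique F m D D' : frechet F m D -> frechet F m D' -> D = D'.
Proof.
move=> dD dD'; apply/funext => i; apply/funext => j.
have tg := @tangent_line m (delta_mx i j).
have := frechet_tangent dD tg; have := frechet_tangent dD' tg.
by rewrite !lin_delta => h1 h2; exact: (cvg_unique _ h2 h1).
Qed.

Lemma cvg_shift0 m : (m + k) @[k --> (0 : 'M[R]_2)] --> m.
Proof.
rewrite -[X in _ --> X]addr0.
by refine (cvgD (cvg_cst m) cvg_id); exact: nbhs_filter.
Qed.

Lemma frechet_ext O F G m D : open O -> O m -> (forall m, O m -> F m = G m) ->
  frechet F m D -> frechet G m D.
Proof.
move=> oO Om FG dF e e0; have := dF e e0.
have : \forall k \near (0 : 'M[R]_2), O (m + k).
  by have /(_ O) := @cvg_shift0 m; apply; apply: open_nbhs_nbhs.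
by apply: filterS2 => k Ok; rewrite FG // FG.
Qed.

Lemma frechet_comb (a : R[i]) F G m D D' : frechet F m D -> frechet G m D' ->
  frechet (fun m => a *: F m + G m) m (fun i j => a *: D i j + D' i j).
Proof.
move=> dF dG e e0; pose b : R := complex.Re `|a|.
have b0 : 0 <= b by rewrite -lecR /b RRe_real ?normr_real // normr_ge0.
have b1 : 0 < b + 1 by rewrite ltr_wpDl.
have e1 : 0 < e / 2 / (b + 1) by rewrite !divr_gt0.
have e2 : 0 < e / 2 by rewrite divr_gt0.
have := dG _ e2; have := dF _ e1; apply: filterS2 => k hF hG.
have -> : lin (fun i j => a *: D i j + D' i j) k = a *: lin D k + lin D' k.
  rewrite /lin scaler_sumr -big_split; apply: eq_bigr => i _.
  rewrite scaler_sumr -big_split; apply: eq_bigr => j _ /=.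
  by rewrite scalerDr !scalerA mulrC.
have -> : a *: F (m + k) + G (m + k) - (a *: F m + G m) - (a *: lin D k + lin D' k) =
   a *: (F (m + k) - F m - lin D k) + (G (m + k) - G m - lin D' k).
  by rewrite !scalerBr !opprD (addrACA (a *: F (m + k))) [LHS]addrACA.
rewrite (le_trans (nrmD _ _)) // [e]splitr mulrDl lerD // nrmZ -/b.
rewrite (le_trans (ler_wpM2l b0 hF)) // mulrA ler_wpM2r //.
by rewrite mulrCA (ler_piMr (ltW e2)) // ler_pdivrMr // mul1r lerDl.
Qed.

(** The remainder is m i0 j0 times that of G plus k i0 j0 *: (G (m + k) - G m),
    and the second term is o(|k|) by continuity of G. *)
Lemma frechet_coord i0 j0 G m D : {for m, continuous G} -> frechet G m D ->
  frechet (fun m => (m i0 j0)%:C *: G m) m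
    (fun i j => (m i0 j0)%:C *: D i j + ((i == i0) && (j == j0))%:R *: G m).
Proof.
move=> cG dG e e0; pose b := `|m i0 j0|.
have b1 : 0 < b + 1 by rewrite ltr_wpDl // normr_ge0.
have e1 : 0 < e / 2 / (b + 1) by rewrite !divr_gt0.
have e2 : 0 < e / 2 by rewrite divr_gt0.
have : \forall k \near (0 : 'M[R]_2), nrm (G (m + k) - G m) <= e / 2.
  have : G (m + k) @[k --> (0 : 'M[R]_2)] --> G m.
    exact: (cvg_comp _ _ (@cvg_shift0 m) cG).
  move=> /cvg_nrmP/cvgr0Pnorm_le/(_ _ e2).
  by apply: filterS => k; exact: le_trans (ler_norm _).
have := dG _ e1; apply: filterS2 => k hG hc.
have -> : lin (fun i j => (m i0 j0)%:C *: D i j + ((i == i0) && (j == j0))%:R *: G m) k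
    = (m i0 j0)%:C *: lin D k + (k i0 j0)%:C *: G m.
  rewrite -[(k i0 j0)%:C *: G m]/((k i0 j0)%:C *: (fun _ _ => G m) i0 j0).
  rewrite /lin scaler_sumr [(k i0 j0)%:C *: _](_ : _ =
      \sum_i \sum_j ((k i j)%:C * ((i == i0) && (j == j0))%:R) *: G m).
    rewrite -big_split; apply: eq_bigr => i _.
    rewrite scaler_sumr -big_split; apply: eq_bigr => j _ /=.
    by rewrite scalerDr !scalerA mulrC.
  rewrite (bigD1 i0) //= (bigD1 j0) //= big1 ?addr0 => [|j jj]; last first.
    by rewrite (negPf jj) andbF mulr0 scale0r.
  rewrite !eqxx mulr1 big1 ?addr0 // => i ii.
  by rewrite big1 // => j _; rewrite (negPf ii) mulr0 scale0r.
have -> : ((m + k) i0 j0)%:C *: G (m + k) - (m i0 j0)%:C *: G m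
     - ((m i0 j0)%:C *: lin D k + (k i0 j0)%:C *: G m) =
   (m i0 j0)%:C *: (G (m + k) - G m - lin D k) + (k i0 j0)%:C *: (G (m + k) - G m).
  rewrite mxE raddfD /= scalerDl !scalerBr opprD !addrA.
  by do 2!rewrite (addrAC _ ((k i0 j0)%:C *: G (m + k))).
rewrite (le_trans (nrmD _ _)) // [e]splitr mulrDl lerD // nrmZr.
  rewrite (le_trans (ler_wpM2l _ hG)) // mulrA ler_wpM2r // -/b.
  by rewrite mulrCA (ler_piMr (ltW e2)) // ler_pdivrMr // mul1r lerDl.
by rewrite mulrC ler_pM ?nrm_ge0 ?mx_coord_le.
Qed.

End Calculus.

(** * Functions of class C^n *)

Section Smooth.
Variables (R : realType) (V : completeNormedModType R[i]).
Implicit Types (O : set 'M[R]_2) (F G : 'M[R]_2 -> V) (m : 'M[R]_2).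

Lemma Cn_onS n O F : Cn_on n.+1 O F <->
  (forall m, O m -> {for m, continuous F}) /\
  exists F' : 'I_2 -> 'I_2 -> 'M[R]_2 -> V,
    (forall m, O m -> frechet F m (fun i j => F' i j m)) /\
    (forall i j, Cn_on n O (F' i j)).
Proof.
by split=> -[cF [F' [dF sF]]]; split=> //; exists F'; split=> // m Om e e0;
  have := dF m Om e e0; apply: filterS => k; rewrite normE lecR.
Qed.

Lemma Cn_onW n O F : Cn_on n.+1 O F -> Cn_on n O F.
Proof.
elim: n F => [|n IH] F; first by case=> cF _; split.
move/Cn_onS=> [cF [F' [dF sF]]]; apply/Cn_onS; split=> //; exists F'; split=> // i j.
exact/IH/sF.
Qed.

Lemma Cn_on_subset n O O' F : O' `<=` O -> Cn_on n O F -> Cn_on n O' F.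
Proof.
move=> sO; elim: n F => [|n IH] F; first by case=> cF _; split=> // m /sO /cF.
move/Cn_onS=> [cF [F' [dF sF]]]; apply/Cn_onS; split=> [m /sO /cF //|].
by exists F'; split=> [m /sO /dF //|i j]; exact/IH/sF.
Qed.

Lemma continuous_on_ext O F G : open O -> (forall m, O m -> F m = G m) ->
  forall m, O m -> {for m, continuous F} -> {for m, continuous G}.
Proof.
move=> oO FG m Om cF; rewrite /prop_for /continuous_at -FG // => A nA.
have : nbhs m O by apply: open_nbhs_nbhs.
have : nbhs m (F @^-1` A) by exact: cF.
by apply: filterS2 => k /= FA Ok; rewrite -FG.
Qed.

Lemma Cn_on_ext n O F G : open O -> (forall m, O m -> F m = G m) ->
  Cn_on n O F -> Cn_on n O G.
Proof.
move=> oO FG; have cG := continuous_on_ext oO FG.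
case: n => [|n]; first by case=> cF _; split=> // m Om; apply: (cG m Om); exact: cF.
move/Cn_onS=> [cF [F' [dF sF]]]; apply/Cn_onS; split=> [m Om|].
  by apply: (cG m Om); exact: cF.
by exists F'; split=> // m Om; apply: (frechet_ext oO Om FG); exact: dF.
Qed.

Lemma Cn_on_comb n O (a : R[i]) F G :
  Cn_on n O F -> Cn_on n O G -> Cn_on n O (fun m => a *: F m + G m).
Proof.
have cc m F1 G1 : {for m, continuous F1} -> {for m, continuous G1} ->
    {for m, continuous (fun m => a *: F1 m + G1 m)}.
  by move=> cF cG; refine (cvgD (cvgZl_tmp cF) cG); exact: nbhs_filter.
elim: n F G => [|n IH] F G.
  by case=> cF _ [cG _]; split=> // m Om; apply: cc; [exact: cF|exact: cG].
move=> /Cn_onS[cF [F' [dF sF]]] /Cn_onS[cG [G' [dG sG]]]; apply/Cn_onS; split.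
  by move=> m Om; apply: cc; [exact: cF|exact: cG].
exists (fun i j m => a *: F' i j m + G' i j m); split=> [m Om|i j]; last exact: IH.
by apply: frechet_comb; [exact: dF|exact: dG].
Qed.

(** The partial derivatives of m i j *: G involve G itself and m i j *: G'; the
    induction therefore uses that G is of class C^n besides its derivatives. *)
Lemma Cn_on_coord n O i j G :
  Cn_on n O G -> Cn_on n O (fun m => (m i j)%:C *: G m).
Proof.
have cc m G1 : {for m, continuous G1} ->
    {for m, continuous (fun m => (m i j)%:C *: G1 m)}.
  by move=> cG; refine (cvgZ (cvg_realC _) cG); exact: coord_continuous.
elim: n G => [|n IH] G; first by case=> cG _; split=> // m Om; apply: cc; exact: cG.
move=> sG; have sG0 := Cn_onW sG.
case/Cn_onS: sG => cG [G' [dG sG']]; apply/Cn_onS; split.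
  by move=> m Om; apply: cc; exact: cG.
exists (fun k l m => ((k == i) && (l == j))%:R *: G m + (m i j)%:C *: G' k l m).
split=> [m Om|k l]; last by apply: Cn_on_comb => //; exact: IH.
have := frechet_coord i j (cG m Om) (dG m Om).
by congr frechet; apply/funext => k; apply/funext => l; rewrite addrC.
Qed.

Definition smooth_on O F := forall n, Cn_on n O F.

Lemma smooth_on0 O : smooth_on O (fun=> 0).
Proof.
elim=> [|n IH]; first by split=> // m _; exact: cst_continuous.
apply/Cn_onS; split=> [m _|]; first exact: cst_continuous.
exists (fun _ _ _ => 0); split=> // m _ e e0; near=> k.
have -> : lin (fun _ _ => 0) k = 0 :> V.
  by rewrite /lin big1 // => i _; rewrite big1 // => j _; rewrite scaler0.
by rewrite !subr0 nrm0 mulr_ge0 // ltW.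
Unshelve. all: by end_near. Qed.

(** Being of class C^n for every n provides partial derivatives that may depend
    on n; uniqueness on the open set O identifies them. *)
Lemma smooth_on_derivative O F : open O -> smooth_on O F ->
  exists F' : 'I_2 -> 'I_2 -> 'M[R]_2 -> V,
    (forall m, O m -> frechet F m (fun i j => F' i j m)) /\
    (forall i j, smooth_on O (F' i j)).
Proof.
move=> oO sF; have /Cn_onS[_ [F' [dF _]]] := sF 1%N; exists F'; split=> // i j n.
have /Cn_onS[_ [G' [dG sG]]] := sF n.+1; apply: (Cn_on_ext oO _ (sG i j)) => m Om.
have := frechet_unique (dG m Om) (dF m Om).
by move=> /(congr1 (fun f => f i j)).
Qed.

(** For F' the derivative of F, this is the derivative of F along the
    left-invariant vector field m |-> m X, whose coefficients are linear in m. *)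
Lemma smooth_on_lin O (F' : 'I_2 -> 'I_2 -> 'M[R]_2 -> V) (X : 'M[R]_2) :
  (forall i j, smooth_on O (F' i j)) ->
  smooth_on O (fun m => lin (fun i j => F' i j m) (m *m X)).
Proof.
move=> sF n.
have hS (I : finType) (H : I -> 'M[R]_2 -> V) : (forall i, Cn_on n O (H i)) ->
    Cn_on n O (fun m => \sum_i H i m).
  move=> sH; have : forall r, Cn_on n O (fun m => \sum_(i <- r) H i m).
    elim=> [|i r IH].
      by under eq_fun do rewrite big_nil; exact: smooth_on0.
    under eq_fun do rewrite big_cons -[H i _]scale1r.
    exact: Cn_on_comb.
  exact.
apply: (hS) => i; apply: (hS) => j.
have -> : (fun m => ((m *m X) i j)%:C *: F' i j m) =
   (fun m => \sum_k (X k j)%:C *: ((m i k)%:C *: F' i j m)).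
  apply/funext => m; rewrite mxE raddf_sum scaler_suml; apply: eq_bigr => k _.
  by rewrite scalerA -rmorphM mulrC.
apply: (hS) => k.
have -> : (fun m => (X k j)%:C *: ((m i k)%:C *: F' i j m)) =
   (fun m => (X k j)%:C *: ((m i k)%:C *: F' i j m) + 0).
  by apply/funext => m; rewrite addr0.
by apply: Cn_on_comb; [exact/Cn_on_coord/sF|exact: smooth_on0].
Qed.

End Smooth.

(** * Exponentials of the basis of sl(2,R) *)

Section OneParameter.
Variable R : realType.
Implicit Types (a b c d t x : R) (X g : 'M[R]_2).

Lemma ord2P (i : 'I_2) : i = iH \/ i = iE.
Proof. by case: i => -[|[|//]] ?; [left|right]; exact: val_inj. Qed.

Lemma mx2P (T : Type) (A B : 'M[T]_2) :
  A iH iH = B iH iH -> A iH iE = B iH iE -> A iE iH = B iE iH -> A iE iE = B iE iE ->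
  A = B.
Proof. by move=> *; apply/matrixP => i j; case: (ord2P i) => ->; case: (ord2P j) => ->. Qed.

Lemma sum2 (W : nmodType) (F : 'I_2 -> W) : \sum_i F i = F iH + F iE.
Proof.
by rewrite big_ord_recl big_ord1; congr (_ + F _); exact: val_inj.
Qed.

Lemma mx22_eta g : g = mx22 (g iH iH) (g iH iE) (g iE iH) (g iE iE).
Proof. by apply: mx2P; rewrite !mxE. Qed.

Lemma mul_mx22 a b c d a' b' c' d' :
  mx22 a b c d *m mx22 a' b' c' d' =
  mx22 (a * a' + b * c') (a * b' + b * d') (c * a' + d * c') (c * b' + d * d').
Proof. by apply: mx2P; rewrite !mxE sum2 !mxE. Qed.

Lemma mulr_mx22 a b c d a' b' c' d' :
  mx22 a b c d * mx22 a' b' c' d' =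
  mx22 (a * a' + b * c') (a * b' + b * d') (c * a' + d * c') (c * b' + d * d').
Proof. exact: mul_mx22. Qed.

Lemma mx22_1 : 1%:M = mx22 1 0 0 1 :> 'M[R]_2.
Proof. by apply: mx2P; rewrite !mxE. Qed.

Lemma scale_mx22 t a b c d : t *: mx22 a b c d = mx22 (t * a) (t * b) (t * c) (t * d).
Proof. by apply: mx2P; rewrite !mxE. Qed.

Lemma det2 g : \det g = g iH iH * g iE iE - g iH iE * g iE iH.
Proof.
rewrite (expand_det_row _ iH) sum2 /cofactor !det_mx11 !mxE.
have -> : lift iH 0 = iE by exact: val_inj.
have -> : lift iE 0 = iH by exact: val_inj.
by rewrite /= expr0 expr1 mul1r mulN1r mulrN.
Qed.

Lemma SL2_mx22 a b c d : a * d - b * c = 1 -> SL2 (mx22 a b c d).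
Proof. by move=> h; rewrite /SL2 /= det2 !mxE. Qed.

Lemma SL2E g : SL2 g -> g iH iH * g iE iE - g iH iE * g iE iH = 1.
Proof. by rewrite /SL2 /= det2. Qed.

Lemma SL2_1 : SL2 (1%:M : 'M[R]_2).
Proof. by rewrite /SL2 /= det1. Qed.

Lemma SL2M g g' : SL2 g -> SL2 g' -> SL2 (g *m g').
Proof. by rewrite /SL2 /= det_mulmx => -> ->; rewrite mulr1. Qed.

Lemma expmx_entries X g :
  (forall i j, series (fun k => (k`!%:R)^-1 * (X ^+ k) i j) n @[n --> \oo] --> g i j) ->
  expmx X = g.
Proof.
move=> h; apply: cvg_lim => //; apply: cvg_mxP => i j.
rewrite [X in X @ _ --> _](_ : _ = series (fun k => (k`!%:R)^-1 * (X ^+ k) i j)) //.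
apply/funext => n; rewrite /series /= summxE.
by apply: eq_bigr => k _; rewrite mxE.
Qed.

Lemma expmx_mx22 X (u v w z : R ^nat) a b c d :
  (forall k, X ^+ k = mx22 (u k) (v k) (w k) (z k)) ->
  series (fun k => (k`!%:R)^-1 * u k) n @[n --> \oo] --> a ->
  series (fun k => (k`!%:R)^-1 * v k) n @[n --> \oo] --> b ->
  series (fun k => (k`!%:R)^-1 * w k) n @[n --> \oo] --> c ->
  series (fun k => (k`!%:R)^-1 * z k) n @[n --> \oo] --> d ->
  expmx X = mx22 a b c d.
Proof.
move=> pw ca cb cc cd; apply: expmx_entries => i j.
case: (ord2P i) => ->; case: (ord2P j) => ->; rewrite [X in _ --> X]mxE /=.
- by rewrite (_ : (fun k => _ * (X ^+ k) _ _) = (fun k => (k`!%:R)^-1 * u k)) //;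
    apply/funext => k; rewrite pw mxE.
- by rewrite (_ : (fun k => _ * (X ^+ k) _ _) = (fun k => (k`!%:R)^-1 * v k)) //;
    apply/funext => k; rewrite pw mxE.
- by rewrite (_ : (fun k => _ * (X ^+ k) _ _) = (fun k => (k`!%:R)^-1 * w k)) //;
    apply/funext => k; rewrite pw mxE.
- by rewrite (_ : (fun k => _ * (X ^+ k) _ _) = (fun k => (k`!%:R)^-1 * z k)) //;
    apply/funext => k; rewrite pw mxE.
Qed.

Lemma cvg_series_eventually_cst (u : R ^nat) N l :
  (forall n, (N <= n)%N -> series u n = l) -> series u n @[n --> \oo] --> l.
Proof.
move=> h; rewrite -(cvg_shiftn N) (_ : (fun n => _) = cst l); first exact: cvg_cst.
by apply/funext => n; rewrite /= h // leq_addl.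
Qed.

Lemma cvg_series0 : series (fun=> 0 : R) n @[n --> \oo] --> (0 : R).
Proof. by apply: (@cvg_series_eventually_cst _ 0) => n _; rewrite seriesEord /= big1. Qed.

Lemma expmx_slH t : expmx (t *: slH R) =
  mx22 (expR (t * (2 * Num.sqrt 2)^-1)) 0 0 (expR (- (t * (2 * Num.sqrt 2)^-1))).
Proof.
set x := t * _.
have -> : t *: slH R = mx22 x 0 0 (- x).
  by rewrite /slH scalerA scale_mx22 !mulr0 mulr1 mulrN1.
have pw k : mx22 x 0 0 (- x) ^+ k = mx22 (x ^+ k) 0 0 ((- x) ^+ k).
  elim: k => [|k IH]; first by rewrite !expr0 -mx22_1.
  by rewrite exprS IH mulr_mx22 !mul0r !mulr0 !addr0 add0r -!exprS.
have ce (y : R) : series (fun k => (k`!%:R)^-1 * y ^+ k) n @[n --> \oo] --> expR y.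
  rewrite (_ : (fun k => (k`!%:R)^-1 * y ^+ k) = exp_coeff y); first exact: is_cvg_series_exp_coeff.
  by apply/funext => k; rewrite mulrC.
have c0 : series (fun k => (k`!%:R)^-1 * (0 : R)) n @[n --> \oo] --> (0 : R).
  by under [X in series X]eq_fun do rewrite mulr0; exact: cvg_series0.
exact: (@expmx_mx22 _ (fun k => x ^+ k) (fun=> 0) (fun=> 0) (fun k => (- x) ^+ k)
  _ _ _ _ pw (ce _) c0 c0 (ce _)).
Qed.

Lemma expmx_slE t : expmx (t *: slE R) = mx22 1 (t / 2) 0 1.
Proof.
set x := t / 2.
have -> : t *: slE R = mx22 0 x 0 0.
  by rewrite /slE scalerA scale_mx22 !mulr0 mulr1.
have pw k : mx22 0 x 0 0 ^+ k.+2 = 0.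
  by rewrite !exprS mulrA mulr_mx22 !mul0r !mulr0 !addr0 (_ : mx22 0 0 0 0 = 0)
    ?mul0r //; apply: mx2P; rewrite !mxE.
apply: expmx_entries => i j.
apply: (@cvg_series_eventually_cst _ 2) => -[|[|n]] // _.
rewrite seriesEord /= 2!big_ord_recl big1 => [|k _]; last first.
  by rewrite pw mxE mulr0.
rewrite addr0 expr0 expr1 invr1 !mul1r.
by case: (ord2P i) => ->; case: (ord2P j) => ->; rewrite !mxE /= ?addr0 ?add0r.
Qed.

Lemma expmx_soK t : expmx (t *: soK R) =
  mx22 (cos (t / 2)) (sin (t / 2)) (- sin (t / 2)) (cos (t / 2)).
Proof.
set x := t / 2.
have -> : t *: soK R = mx22 0 x (- x) 0.
  by rewrite /soK scale_mx22 !mulr0 mulrN.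
pose ck k : R := (~~ odd k)%:R * (-1) ^+ k./2 * x ^+ k.
pose sk k : R := (odd k)%:R * (-1) ^+ k.-1./2 * x ^+ k.
have pw k : mx22 0 x (- x) 0 ^+ k = mx22 (ck k) (sk k) (- sk k) (ck k).
  elim: k => [|k IH].
    by rewrite expr0 /ck /sk /= !(mul0r, mul1r, oppr0) -mx22_1.
  have e1 : ck k.+1 = - (x * sk k).
    rewrite /ck /sk /= negbK exprS; case: k {IH} => [|k] /=; first by rewrite !mul0r mulr0 oppr0.
    by case: (odd k); rewrite /= ?mul0r ?mulr0 ?oppr0 //= !mul1r exprS; ring.
  have e2 : sk k.+1 = x * ck k by rewrite /ck /sk /= exprS; ring.
  rewrite exprS IH mulr_mx22 e1 e2; congr mx22; ring.
have cc : series (fun k => (k`!%:R)^-1 * ck k) n @[n --> \oo] --> cos x.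
  rewrite (_ : (fun k => (k`!%:R)^-1 * ck k) = cos_coeff x); last by apply/funext => k; rewrite mulrC.
  by rewrite unlock; exact: is_cvg_series_cos_coeff.
have cs : series (fun k => (k`!%:R)^-1 * sk k) n @[n --> \oo] --> sin x.
  rewrite (_ : (fun k => (k`!%:R)^-1 * sk k) = sin_coeff x); last by apply/funext => k; rewrite mulrC.
  by rewrite unlock; exact: is_cvg_series_sin_coeff.
apply: (@expmx_mx22 _ ck sk (fun k => - sk k) ck _ _ _ _ pw) => //.
apply: cvg_trans (cvgN cs); apply: near_eq_cvg; near=> n.
by rewrite fctE /series /= -sumrN; apply: eq_bigr => k _; rewrite mulrN.
Unshelve. all: by end_near. Qed.

End OneParameter.

(** * Tangents and one-parameter groups *)

Section Tangents.
Variable R : realType.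
Implicit Types (t s c : R) (X m g k : 'M[R]_2).

Lemma cvg_mulmx {T : Type} {F : set_system T} {FF : Filter F} (f h : T -> 'M[R]_2) m g :
  f x @[x --> F] --> m -> h x @[x --> F] --> g -> (f x *m h x) @[x --> F] --> m *m g.
Proof.
move=> cf ch; apply: cvg_mxP => i j; rewrite mxE.
under eq_fun do rewrite mxE.
apply: cvg_big => [|k _]; first exact: add_continuous.
by apply: cvgM; exact: cvg_mx_coord.
Qed.

Lemma tangent_mull (gam : R -> 'M[R]_2) m X g :
  tangent gam m X -> tangent (fun t => g *m gam t) (g *m m) (g *m X).
Proof.
move=> tg; rewrite /tangent (_ : (fun t => _) = fun t => g *m (t^-1 *: (gam t - m))).
  by apply: cvg_mulmx => //; exact: cvg_cst.
by apply/funext => t; rewrite -scalemxAr mulmxBr.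
Qed.

Lemma tangent_mulr (gam : R -> 'M[R]_2) m X g :
  tangent gam m X -> tangent (fun t => gam t *m g) (m *m g) (X *m g).
Proof.
move=> tg; rewrite /tangent (_ : (fun t => _) = fun t => (t^-1 *: (gam t - m)) *m g).
  by apply: cvg_mulmx => //; exact: cvg_cst.
by apply/funext => t; rewrite -scalemxAl mulmxBl.
Qed.

Lemma derive_quotient (f : R -> R) (df : R) : is_derive (0 : R) (1 : R) f df ->
  t^-1 * (f t - f 0) @[t --> 0^'] --> df.
Proof.
move=> [dv <-]; move: dv; rewrite /derivable /derive => dv.
rewrite (_ : (fun t => t^-1 * _) =
  (fun t : R => t^-1 *: ((f \o shift 0) (t *: (1 : R)) - f 0))) //.
by apply/funext => t; rewrite /= addr0 [t *: _]mulr1.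
Qed.

Lemma is_derive_scaled (f : R -> R) (df c : R) : is_derive (0 : R) (1 : R) f df ->
  is_derive (0 : R) (1 : R) (fun t => f (t * c)) (df * c).
Proof.
move=> df0; have h : is_derive (0 : R) (1 : R) (fun t => t * c) c.
  have : is_derive (0 : R) (1 : R) (c \*: id) (c *: (1 : R)) by apply: is_deriveZ.
  rewrite [c *: _]mulr1; congr is_derive; apply/funext => t /=; exact: mulrC.
apply: (@is_derive1_comp _ f (fun t => t * c)); by rewrite mul0r.
Qed.

(** What is used of the curve t |-> exp(tX).  It is verified on explicit matrices
    for H, E and the generator of SO(2). *)
Record one_param X : Prop := OneParam {
  op_SL2 : forall t, SL2 (expmx (t *: X)) ;
  op_tangent : tangent (fun t => expmx (t *: X)) 1%:M X ;
  op_inv : forall t, expmx (t *: X) *m expmx (- t *: X) = 1%:M }.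

Lemma one_param_slH : one_param (slH R).
Proof.
split=> [t||t]; rewrite ?expmx_slH.
- by apply: SL2_mx22; rewrite mulr0 subr0 -expRD subrr expR0.
- pose c : R := (2 * Num.sqrt 2)^-1.
  have d : is_derive (0 : R) (1 : R) (fun t => expR (t * c)) (1 * c).
    by apply: is_derive_scaled; apply: is_derive_eq; exact: expR0.
  have d' : is_derive (0 : R) (1 : R) (fun t => expR (t * - c)) (1 * - c).
    by apply: is_derive_scaled; apply: is_derive_eq; exact: expR0.
  have z : (t^-1 * (0 - 0) : R) @[t --> (0:R)^'] --> (0 : R).
    by under eq_fun do rewrite subrr mulr0; exact: cvg_cst.
  apply: cvg_mxP => i j.
  under eq_fun do rewrite expmx_slH mx22_1 /=.
  case: (ord2P i) => ->; case: (ord2P j) => -> /=; rewrite !mxE /= -/c.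
  + under eq_fun do rewrite !mxE /=.
    by have := derive_quotient d; rewrite mul0r expR0 mul1r mulr1.
  + by under eq_fun do rewrite !mxE /=; rewrite mulr0.
  + by under eq_fun do rewrite !mxE /=; rewrite mulr0.
  + under eq_fun do rewrite !mxE /= -mulrN.
    by have := derive_quotient d'; rewrite mul0r expR0 mul1r mulrN1.
- rewrite mul_mx22 mx22_1 !mulr0 !mul0r !addr0 !add0r -!expRD.
  by rewrite mulNr opprK subrr addNr expR0.
Qed.

Lemma one_param_slE : one_param (slE R).
Proof.
split=> [t||t]; rewrite ?expmx_slE.
- by apply: SL2_mx22; rewrite mulr0 subr0 mulr1.
- have -> : (fun t => expmx (t *: slE R)) = (fun t => 1%:M + t *: slE R).
    apply/funext => t; rewrite expmx_slE mx22_1.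
    by apply: mx2P; rewrite !mxE /= ?(mulr0, addr0, add0r, mulr1).
  exact: tangent_line.
- rewrite mul_mx22 mx22_1 !mulr0 !mul0r !addr0 !add0r !mulr1 !mul1r.
  by rewrite mulNr addNr.
Qed.

Lemma one_param_soK : one_param (soK R).
Proof.
split=> [t||t]; rewrite ?expmx_soK.
- by apply: SL2_mx22; rewrite mulrN opprK -!expr2 cos2Dsin2.
- have d : is_derive (0 : R) (1 : R) (fun t => sin (t * 2^-1)) (1 * 2^-1).
    by apply: is_derive_scaled; apply: is_derive_eq; exact: cos0.
  have d' : is_derive (0 : R) (1 : R) (fun t => cos (t * 2^-1)) (- 0 * 2^-1).
    by apply: is_derive_scaled; apply: is_derive_eq; rewrite sin0.
  have cs := derive_quotient d; have cc := derive_quotient d'.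
  rewrite mul0r sin0 mul1r in cs; rewrite mul0r cos0 oppr0 mul0r in cc.
  apply: cvg_mxP => i j.
  under eq_fun do rewrite expmx_soK mx22_1 /=.
  case: (ord2P i) => ->; case: (ord2P j) => -> /=; rewrite !mxE /=.
  + by under eq_fun do rewrite !mxE /=.
  + by under eq_fun do rewrite !mxE /=.
  + apply: cvg_trans (cvgN cs); apply: near_eq_cvg; near=> t.
    by rewrite !mxE /= fctE !subr0 mulrN.
  + by under eq_fun do rewrite !mxE /=.
- rewrite mul_mx22 mx22_1 mulNr cosN sinN opprK.
  congr mx22; rewrite ?mulrN ?mulNr ?opprK -?expr2 ?cos2Dsin2 //.
  + by rewrite mulrC addNr.
  + by rewrite mulrC addNr.
  + by rewrite addrC cos2Dsin2.
Unshelve. all: by end_near. Qed.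

Lemma expmx_slED s t : expmx ((s + t) *: slE R) = expmx (s *: slE R) *m expmx (t *: slE R).
Proof.
rewrite !expmx_slE mul_mx22 !(mul0r, mulr0, mul1r, mulr1, addr0, add0r).
by rewrite mulrDl addrC.
Qed.

(** The group form of [H, E] = E / sqrt 2. *)
Lemma expmx_slHE s t : expmx (t *: slH R) *m expmx (s *: slE R) =
  expmx ((expR (t * (Num.sqrt 2)^-1) * s) *: slE R) *m expmx (t *: slH R).
Proof.
rewrite !expmx_slE expmx_slH !mul_mx22 !(mul0r, mulr0, mul1r, mulr1, addr0, add0r).
congr mx22; set c := t * _.
have -> : t * (Num.sqrt 2)^-1 = c + c.
  by rewrite /c invfM; field; rewrite sqrtr_eq0 -ltNge.
rewrite expRD expRN; field.
by rewrite gt_eqF // expR_gt0.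
Qed.

End Tangents.

(** * Inner products *)

Section InnerProduct.
Variables (R : realType) (V : completeNormedModType R[i]) (ip : V -> V -> R[i]).
Hypothesis Hip : inner_product ip.
Implicit Types (u v w : V) (a : R[i]).

Lemma ipDl u v w : ip (u + v) w = ip u w + ip v w.
Proof. by have := ip_linear Hip 1 u v w; rewrite scale1r mul1r. Qed.

Lemma ip0l w : ip 0 w = 0.
Proof. by apply: (addrI (ip 0 w)); rewrite -ipDl !addr0. Qed.

Lemma ipZl a u w : ip (a *: u) w = a * ip u w.
Proof. by have := ip_linear Hip a u 0 w; rewrite addr0 ip0l addr0. Qed.

Lemma ipNl u w : ip (- u) w = - ip u w.
Proof. by rewrite -scaleN1r ipZl mulN1r. Qed.

Lemma ipBl u v w : ip (u - v) w = ip u w - ip v w.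
Proof. by rewrite ipDl ipNl. Qed.

Lemma ipDr u v w : ip u (v + w) = ip u v + ip u w.
Proof. by rewrite (ip_conj Hip) ipDl rmorphD /= -!(ip_conj Hip). Qed.

Lemma ipZr a u w : ip u (a *: w) = Num.conj a * ip u w.
Proof. by rewrite (ip_conj Hip) ipZl rmorphM /= -(ip_conj Hip). Qed.

Lemma ipNr u w : ip u (- w) = - ip u w.
Proof. by rewrite (ip_conj Hip) ipNl rmorphN /= -(ip_conj Hip). Qed.

Lemma ipBr u v w : ip u (v - w) = ip u v - ip u w.
Proof. by rewrite ipDr ipNr. Qed.

Lemma ip_sq v : ip v v = ((nrm v) ^+ 2)%:C.
Proof. by rewrite -ip_norm // normE rmorphXn. Qed.

Lemma ip_eq0 v : ip v v = 0 -> v = 0.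
Proof.
rewrite ip_sq => /realC_inj/eqP; rewrite sqrf_eq0 => /eqP; exact: nrm_eq0.
Qed.

(** Polarization; it reduces the continuity of the inner product to that of the
    norm. *)
Lemma Re_ip u w : complex.Re (ip u w) =
  (nrm (u + w) ^+ 2 - nrm u ^+ 2 - nrm w ^+ 2) / 2.
Proof.
have : ((nrm (u + w) ^+ 2 - nrm u ^+ 2 - nrm w ^+ 2)%:C : R[i]) = ip u w + Num.conj (ip u w).
  rewrite !rmorphB /= -!ip_sq -(ip_conj Hip) // ipDl !ipDr; ring.
move=> /(congr1 (@complex.Re R)) /= ->; case: (ip u w) => a b /=; by field.
Qed.

Lemma Im_ip u w : complex.Im (ip u w) = complex.Re (ip (- 'i%C *: u) w).
Proof. by rewrite ipZl; case: (ip u w) => a b; simpc. Qed.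

Lemma cvg_nrm {T : Type} {F : set_system T} {FF : Filter F} (f : T -> V) v :
  f x @[x --> F] --> v -> nrm (f x) @[x --> F] --> nrm v.
Proof.
move=> /cvg_nrmP/cvgr0Pnorm_le cf; apply/cvgrPdist_le => e e0.
apply: filterS (cf _ e0) => x; rewrite ger0_norm ?nrm_ge0 //; apply: le_trans.
by rewrite distrC -lecR -normc_real rmorphB /= -!normE ler_dist_dist.
Qed.

Lemma cvg_ipl {T : Type} {F : set_system T} {FF : Filter F} (f : T -> V) v w :
  f x @[x --> F] --> v -> (ip (f x) w : R[i]^o) @[x --> F] --> (ip v w : R[i]^o).
Proof.
have re g u : g x @[x --> F] --> u -> complex.Re (ip (g x) w) @[x --> F] --> complex.Re (ip u w).
  move=> cg; rewrite Re_ip; under eq_fun do rewrite Re_ip.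
  apply: cvgMr_tmp; apply: cvgB; last exact: cvg_cst.
  by apply: cvgB; rewrite expr2; under eq_fun do rewrite expr2; apply: cvgM;
    apply: cvg_nrm => //; apply: cvgD => //; exact: cvg_cst.
move=> cf; apply: cvg_complexP; first exact: re.
rewrite Im_ip; under eq_fun do rewrite Im_ip.
by apply: re; exact: cvgZl_tmp.
Qed.

Lemma cvg_ipr {T : Type} {F : set_system T} {FF : Filter F} (f : T -> V) v w :
  f x @[x --> F] --> v -> (ip w (f x) : R[i]^o) @[x --> F] --> (ip w v : R[i]^o).
Proof.
have re g u : g x @[x --> F] --> u -> complex.Re (ip w (g x)) @[x --> F] --> complex.Re (ip w u).
  move=> cg; rewrite Re_ip; under eq_fun do rewrite Re_ip.
  apply: cvgMr_tmp; rewrite expr2; under eq_fun do rewrite !expr2.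
  apply: cvgB; [apply: cvgB; last exact: cvg_cst|].
    by apply: cvgM; apply: cvg_nrm => //; apply: cvgD => //; exact: cvg_cst.
  by rewrite expr2; apply: cvgM; exact: cvg_nrm.
have im u : complex.Im (ip w u) = complex.Re (ip w ('i%C *: u)).
  by rewrite ipZr; case: (ip w u) => a b /=; simpc.
move=> cf; apply: cvg_complexP; first exact: re.
rewrite im; under eq_fun do rewrite im.
by apply: re; exact: cvgZl_tmp.
Qed.

End InnerProduct.

(** * Smooth vectors and the derived representation *)

Section SmoothVectors.
Variables (R : realType) (V : completeNormedModType R[i]) (ip : V -> V -> R[i]).
Variable U : 'M[R]_2 -> V -> V.
Hypotheses (Hip : inner_product ip) (HU : unitary_rep ip U).
Implicit Types (u v w : V) (a : R[i]) (g m X : 'M[R]_2) (t : R).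

Lemma repD g u v : SL2 g -> U g (u + v) = U g u + U g v.
Proof. by move=> gS; have := urep_linear HU gS 1 u v; rewrite !scale1r. Qed.

Lemma rep0 g : SL2 g -> U g 0 = 0.
Proof. by move=> gS; apply: (addrI (U g 0)); rewrite -repD // !addr0. Qed.

Lemma repZ g a u : SL2 g -> U g (a *: u) = a *: U g u.
Proof. by move=> gS; have := urep_linear HU gS a u 0; rewrite addr0 rep0 // addr0. Qed.

Lemma repB g u v : SL2 g -> U g (u - v) = U g u - U g v.
Proof. by move=> gS; rewrite repD // -scaleN1r repZ // scaleN1r. Qed.

Lemma nrm_rep g v : SL2 g -> nrm (U g v) = nrm v.
Proof.
move=> gS; apply/eqP; rewrite -(eqrXn2 (n := 2)) ?nrm_ge0 //.
by apply/eqP/realC_inj; rewrite -!(ip_sq Hip) (urep_unitary HU).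
Qed.

Lemma cvg_rep {T : Type} {F : set_system T} {FF : Filter F} g (f : T -> V) v :
  SL2 g -> f x @[x --> F] --> v -> U g (f x) @[x --> F] --> U g v.
Proof.
move=> gS /cvg_nrmP cf; apply/cvg_nrmP.
by under eq_fun do rewrite -repB // nrm_rep //.
Qed.

(** The chain rule for a smooth local extension of the orbit map. *)
Lemma orbit_deriv v g : Cinf U v -> SL2 g ->
  exists (O : set 'M[R]_2) (D : 'I_2 -> 'I_2 -> 'M[R]_2 -> V),
  [/\ open O, O g, forall i j, smooth_on O (D i j) &
   forall m, O m -> SL2 m -> forall (gam : R -> 'M[R]_2) X,
    (forall t, SL2 (gam t)) -> tangent gam m X ->
    (t^-1)%:C *: (U (gam t) v - U m v) @[t --> 0^'] --> lin (fun i j => D i j m) X].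
Proof.
move=> sv gS; have [B [F [oB Bg FU sF]]] := sv g gS.
have [D [dF sD]] : exists D : 'I_2 -> 'I_2 -> 'M[R]_2 -> V,
    (forall m, B m -> frechet F m (fun i j => D i j m)) /\ (forall i j, smooth_on B (D i j)).
  exact: smooth_on_derivative oB sF.
exists B, D; split=> // m Bm mS gam X gamS tg.
have := frechet_tangent (dF m Bm) tg; apply: cvg_trans; apply: near_eq_cvg.
near=> t; rewrite !FU //.
by near: t; apply: (tangent_cvg tg); exact: open_nbhs_nbhs.
Unshelve. all: by end_near. Qed.

(** A single real-linear map computes the derivatives at 1 along all curves in
    SL(2,R); this is the linearity of X |-> pi(X) v. *)
Lemma tangent_at1 v : Cinf U v -> exists D : 'I_2 -> 'I_2 -> V,
  forall (gam : R -> 'M[R]_2) X, (forall t, SL2 (gam t)) -> tangent gam 1%:M X ->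
    (t^-1)%:C *: (U (gam t) v - v) @[t --> 0^'] --> lin D X.
Proof.
move=> sv; have [B [D [_ B1 _ dD]]] := orbit_deriv sv (SL2_1 R).
exists (fun i j => D i j 1%:M) => gam X gamS tg.
by have := dD _ B1 (SL2_1 R) gam X gamS tg; rewrite (urep1 HU).
Qed.

Lemma dU_cvg v X : one_param X -> Cinf U v ->
  (t^-1)%:C *: (U (expmx (t *: X)) v - v) @[t --> 0^'] --> dU U X v.
Proof.
move=> oX sv; have [D dD] := tangent_at1 sv.
have := dD _ _ (op_SL2 oX) (op_tangent oX) => c.
by rewrite /dU (cvg_lim _ c).
Qed.

Lemma dU_lim v w X : one_param X -> Cinf U v ->
  (t^-1)%:C *: (U (expmx (t *: X)) v - v) @[t --> 0^'] --> w -> dU U X v = w.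
Proof. by move=> oX sv cw; exact: (cvg_unique _ (dU_cvg oX sv) cw). Qed.

Lemma Cinf_comb a u v : Cinf U u -> Cinf U v -> Cinf U (a *: u + v).
Proof.
move=> su sv g gS.
have [B [F [oB Bg FU sF]]] := su g gS; have [B' [G [oB' Bg' GU sG]]] := sv g gS.
exists (B `&` B'), (fun m => a *: F m + G m); split=> //; first exact: openI.
- by move=> m [Bm Bm'] mS; rewrite FU // GU // (urep_linear HU).
- move=> n; apply: Cn_on_comb.
    by apply: Cn_on_subset (sF n) => m [].
  by apply: Cn_on_subset (sG n) => m [].
Qed.

Lemma Cinf0 : Cinf U 0.
Proof.
move=> g gS; exists setT, (fun=> 0); split=> //; first exact: openT.
- by move=> m _ mS; rewrite rep0.
- exact: smooth_on0.
Qed.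

Lemma CinfZ a u : Cinf U u -> Cinf U (a *: u).
Proof. by move=> su; rewrite -[_ *: _]addr0; apply: Cinf_comb => //; exact: Cinf0. Qed.

Lemma CinfD u v : Cinf U u -> Cinf U v -> Cinf U (u + v).
Proof. by move=> su sv; rewrite -[u]scale1r; exact: Cinf_comb. Qed.

Lemma CinfN u : Cinf U u -> Cinf U (- u).
Proof. by move=> su; rewrite -scaleN1r; exact: CinfZ. Qed.

Lemma CinfB u v : Cinf U u -> Cinf U v -> Cinf U (u - v).
Proof. by move=> su sv; apply: CinfD => //; exact: CinfN. Qed.

Lemma rep_dU_cvg v X g : one_param X -> Cinf U v -> SL2 g ->
  (t^-1)%:C *: (U (g *m expmx (t *: X)) v - U g v) @[t --> 0^'] --> U g (dU U X v).
Proof.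
move=> oX sv gS; apply: cvg_trans (cvg_rep gS (dU_cvg oX sv)); apply: near_eq_cvg; near=> t.
by rewrite repZ // repB // (urepM HU) //; exact: op_SL2.
Unshelve. all: by end_near. Qed.

(** U m (pi(X) v) is the derivative of the orbit map of v along m X, and that
    derivative is given near g by a smooth extension. *)
Lemma Cinf_dU v X : one_param X -> Cinf U v -> Cinf U (dU U X v).
Proof.
move=> oX sv g gS; have [B [D [oB Bg sD dD]]] := orbit_deriv sv gS.
exists B, (fun m => lin (fun i j => D i j m) (m *m X)); split=> //.
- move=> m Bm mS; have tg := tangent_mull (g := m) (op_tangent oX).
  rewrite mulmx1 in tg.
  have := dD m Bm mS _ _ (fun t => SL2M mS (op_SL2 oX t)) tg.
  by move=> c; exact: (cvg_unique _ c (rep_dU_cvg oX sv mS)).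
- exact: smooth_on_lin.
Qed.

Lemma dU_comb X a u v : one_param X -> Cinf U u -> Cinf U v ->
  dU U X (a *: u + v) = a *: dU U X u + dU U X v.
Proof.
move=> oX su sv; apply: dU_lim => //; first exact: Cinf_comb.
apply: cvg_trans (cvgD (cvgZl_tmp (k := a) (dU_cvg oX su)) (dU_cvg oX sv)); apply: near_eq_cvg; near=> t.
rewrite !fctE /= (urep_linear HU); last exact: op_SL2.
rewrite scalerA (mulrC a) -scalerA -scalerDr; congr (_ *: _).
by rewrite scalerBr opprD addrACA.
Unshelve. all: by end_near. Qed.

Lemma dUD X u v : one_param X -> Cinf U u -> Cinf U v ->
  dU U X (u + v) = dU U X u + dU U X v.
Proof. by move=> oX su sv; have := dU_comb 1 oX su sv; rewrite !scale1r. Qed.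

Lemma dU0 X : one_param X -> dU U X 0 = 0.
Proof.
move=> oX; apply: (addrI (dU U X 0)).
by rewrite -dUD ?addr0 //; exact: Cinf0.
Qed.

Lemma dUZ X a u : one_param X -> Cinf U u -> dU U X (a *: u) = a *: dU U X u.
Proof.
by move=> oX su; have := dU_comb a oX su Cinf0; rewrite dU0 // !addr0.
Qed.

Lemma dUN X u : one_param X -> Cinf U u -> dU U X (- u) = - dU U X u.
Proof. by move=> oX su; rewrite -scaleN1r dUZ // scaleN1r. Qed.

Lemma rep_adj X t u w : one_param X ->
  ip (U (expmx (t *: X)) u) w = ip u (U (expmx (- t *: X)) w).
Proof.
move=> oX; have tS := op_SL2 oX t; have mS := op_SL2 oX (- t).
rewrite -{1}[w](urep1 HU) -[1]/(1%:M) -(op_inv oX t) (urepM HU) //.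
exact: (urep_unitary HU).
Qed.

Lemma cvgN0 : - t @[t --> (0 : R)^'] --> (0 : R)^'.
Proof.
move=> A /= /nbhs_ballP[e /= e0 eA]; apply/nbhs_ballP; exists e => //= t.
rewrite -ball_normE /= sub0r normrN => te t0; apply: eA.
  by rewrite -ball_normE /= sub0r normrN normrN.
by rewrite oppr_eq0.
Qed.

Lemma conj_realC t : Num.conj (t%:C : R[i]) = t%:C.
Proof. exact: conjc_real. Qed.

(** Unitarity gives <U(exp tX) u, w> = <u, U(exp(-tX)) w>, which is
    differentiated at t = 0. *)
Lemma dU_skew X u w : one_param X -> Cinf U u -> Cinf U w ->
  ip (dU U X u) w = - ip u (dU U X w).
Proof.
move=> oX su sw; have c1 : (ip ((t^-1)%:C *: (U (expmx (t *: X)) u - u)) w : R[i]^o) @[t --> (0:R)^']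
    --> (ip (dU U X u) w : R[i]^o) by exact: cvg_ipl (dU_cvg oX su).
have c2 : (ip ((t^-1)%:C *: (U (expmx (t *: X)) u - u)) w : R[i]^o) @[t --> (0:R)^']
    --> (- ip u (dU U X w) : R[i]^o).
  apply: cvg_trans (cvgN (cvg_ipr Hip (cvg_comp _ _ cvgN0 (dU_cvg oX sw)))); apply: near_eq_cvg; near=> t.
  rewrite !fctE /= (ipZl Hip) (ipZr Hip) (ipBl Hip) (ipBr Hip) rep_adj //.
  by rewrite conj_realC invrN rmorphN /=; ring.
exact: (cvg_unique _ c1 c2).
Unshelve. all: by end_near. Qed.

End SmoothVectors.

(** * The bracket relation and the injectivity of pi(E) *)

Section Relations.
Variables (R : realType) (V : completeNormedModType R[i]) (ip : V -> V -> R[i]).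
Variable U : 'M[R]_2 -> V -> V.
Hypotheses (Hip : inner_product ip) (HU : unitary_rep ip U).
Implicit Types (u v w : V) (a : R[i]) (g m X : 'M[R]_2) (t s c x y : R).
Local Notation H := (slH R).
Local Notation E := (slE R).
Local Notation r := ((Num.sqrt 2)^-1 : R).

Lemma cvg_mul0 c : c != 0 -> c * t @[t --> (0 : R)^'] --> (0 : R)^'.
Proof.
move=> c0 A /= /nbhs_ballP[e /= e0 eA].
apply/nbhs_ballP; exists (e / `|c|) => /=; first by rewrite divr_gt0 ?normr_gt0.
move=> t; rewrite -ball_normE /= sub0r normrN => te t0; apply: eA.
  by rewrite -ball_normE /= sub0r normrN normrM mulrC -ltr_pdivlMr ?normr_gt0.
by rewrite mulf_neq0.
Qed.

Lemma realCNM x y : - x%:C * y%:C = (- x * y)%:C :> R[i].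
Proof. by rewrite -rmorphN -rmorphM. Qed.

(** exp(-tH) exp(sE) = exp(s e^(-t/sqrt 2) E) exp(-tH) is differentiated at
    s = 0.  The derivatives fall on v and w themselves, which are smooth vectors. *)
Lemma ip_rep_slH v w t : Cinf U v -> Cinf U w ->
  ip (U (expmx (t *: H)) v) (dU U E w) =
  - (expR (- t * r))%:C * ip (U (expmx (t *: H)) (dU U E v)) w.
Proof.
move=> sv sw; have oE := one_param_slE R; have oH := one_param_slH R.
rewrite !(rep_adj HU) //; set g := expmx (- t *: H).
have gS : SL2 g by exact: (op_SL2 oH).
set k := expR _; have k0 : - k != 0 by rewrite oppr_eq0 gt_eqF // expR_gt0.
have c1 : (ip v ((s^-1)%:C *: (U (g *m expmx (s *: E)) w - U g w)) : R[i]^o)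
    @[s --> (0 : R)^'] --> (ip v (U g (dU U E w)) : R[i]^o).
  by apply: (cvg_ipr Hip); apply: (rep_dU_cvg Hip HU).
suff c2 : (ip v ((s^-1)%:C *: (U (g *m expmx (s *: E)) w - U g w)) : R[i]^o)
    @[s --> (0 : R)^'] --> (- k%:C * ip (dU U E v) (U g w) : R[i]^o).
  exact: (cvg_unique _ c1 c2).
have c3 := cvg_comp _ _ (cvg_mul0 k0) (dU_cvg HU oE sv).
apply: cvg_trans (cvgMl_tmp (a := - k%:C : R[i]) (cvg_ipl Hip (w := U g w) c3)).
apply: near_eq_cvg; near=> s => /=.
have s0 : s != 0 by near: s; exact: nbhs_dnbhs_neq.
rewrite (ipZr Hip) conj_realC (ipZl Hip) (ipBr Hip) (ipBl Hip) /g expmx_slHE -/g.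
have -> : expR (- t * r) * s = - (- k * s) by rewrite -/k (mulNr k) opprK.
have nS : SL2 (expmx (- (- k * s) *: E)) by exact: (op_SL2 oE).
rewrite (urepM HU nS gS).
rewrite -(rep_adj HU (- k * s) v (U g w) oE) mulrA; congr (_ * _).
by rewrite realCNM invfM mulrA (divff k0) mul1r.
Unshelve. all: by end_near. Qed.

Lemma Cinf_ip_inj u v : Cinf U u -> Cinf U v ->
  (forall w, Cinf U w -> ip u w = ip v w) -> u = v.
Proof.
move=> su sv uv; apply/eqP; rewrite -subr_eq0; apply/eqP/(ip_eq0 Hip).
by rewrite (ipBl Hip) uv ?subrr //; exact: (CinfB HU).
Qed.

(** Differentiating [ip_rep_slH] at t = 0 gives the relation paired with any
    smooth w; both sides are smooth vectors, so [Cinf_ip_inj] applies. *)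
Lemma dU_bracket v : Cinf U v ->
  dU U H (dU U E v) = dU U E (dU U H v) + r%:C *: dU U E v.
Proof.
move=> sv; have oE := one_param_slE R; have oH := one_param_slH R.
have sE := Cinf_dU Hip HU oE sv; have sH := Cinf_dU Hip HU oH sv.
have weak w : Cinf U w ->
    ip (dU U H (dU U E v)) w = ip (dU U E (dU U H v)) w + r%:C * ip (dU U E v) w.
  (* The skewness of pi(E) leaves <pi(H) v, pi(E) w> to be computed. *)
  move=> sw; have aux (b c d z q : R[i]) : b = - d -> d = - c + q * z -> c = b + q * z.
    by move=> -> ->; rewrite opprD opprK -addrA addNr addr0.
  apply: (aux _ _ _ _ _ (dU_skew Hip HU oE sH sw)).
  have c1 : (ip ((t^-1)%:C *: (U (expmx (t *: H)) v - v)) (dU U E w) : R[i]^o)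
      @[t --> (0:R)^'] --> (ip (dU U H v) (dU U E w) : R[i]^o).
    exact: (cvg_ipl Hip (dU_cvg HU oH sv)).
  have ce : t^-1 * (expR (t * - r) - 1) @[t --> (0:R)^'] --> - r.
    have d : is_derive (0 : R) (1 : R) (fun t => expR (t * - r)) (1 * - r).
      by apply: is_derive_scaled; apply: is_derive_eq; exact: expR0.
    by have := derive_quotient d; rewrite mul0r expR0 mul1r.
  have ce1 : expR (t * - r) @[t --> (0:R)^'] --> (1 : R).
    have ct : t * - r @[t --> (0 : R)^'] --> (0 : R).
      by rewrite -[X in _ --> X](mul0r (- r)); apply: cvgMr_tmp; exact: nbhs_dnbhs.
    by have := cvg_comp _ _ ct (@continuous_expR R 0); rewrite expR0.
  have c2 : (ip ((t^-1)%:C *: (U (expmx (t *: H)) (dU U E v) - dU U E v)) w : R[i]^o)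
      @[t --> (0:R)^'] --> (ip (dU U H (dU U E v)) w : R[i]^o).
    exact: (cvg_ipl Hip (dU_cvg HU oH sE)).
  have -> : - ip (dU U H (dU U E v)) w + r%:C * ip (dU U E v) w =
      (- 1)%:C * ip (dU U H (dU U E v)) w + (- - r)%:C * ip (dU U E v) w.
    by rewrite opprK rmorphN1 mulN1r.
  (* The difference quotient of ip_rep_slH at t = 0, by the product rule. *)
  suff c3 : (ip ((t^-1)%:C *: (U (expmx (t *: H)) v - v)) (dU U E w) : R[i]^o)
      @[t --> (0:R)^'] --> ((- 1)%:C * ip (dU U H (dU U E v)) w +
         (- - r)%:C * ip (dU U E v) w : R[i]^o).
    exact: (cvg_unique _ c1 c3).
  apply: cvg_trans (cvgD (cvgM (cvg_realC (cvgN ce1)) c2)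
     (cvgMr_tmp (b := ip (dU U E v) w : R[i]) (cvg_realC (cvgN ce)))).
  apply: near_eq_cvg; near=> t.
  rewrite !fctE /= !(ipZl Hip) !(ipBl Hip) ip_rep_slH // (_ : ip v _ = - ip (dU U E v) w); last first.
    by rewrite (dU_skew Hip HU oE) // opprK.
  have -> : - t * r = t * - r by rewrite mulNr mulrN.
  rewrite !rmorphN !rmorphM !rmorphB /= rmorph1; ring.
apply: Cinf_ip_inj.
- exact: (Cinf_dU Hip HU).
- by apply: (CinfD HU); [exact: (Cinf_dU Hip HU oE sH)|exact: (CinfZ HU)].
- by move=> w sw; rewrite (ipDl Hip) (ipZl Hip); exact: weak.
Unshelve. all: by end_near. Qed.

Lemma rep_curve_cvg (gam : R -> 'M[R]_2) m v : (forall t, SL2 (gam t)) -> SL2 m ->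
  gam t @[t --> (0 : R)^'] --> m -> U (gam t) v @[t --> (0 : R)^'] --> U m v.
Proof.
move=> gS mS cg; have /subspace_continuousP/(_ _ mS) cU := @urep_continuous _ _ _ _ HU v.
move=> A /cU; rewrite /within /= => nA.
have : \forall t \near (0 : R)^', SL2 (gam t) -> A (U (gam t) v) := cg _ nA.
by apply: filterS => t; apply.
Qed.

Definition low c : 'M[R]_2 := mx22 1 0 c 1.

Lemma low_SL2 c : SL2 (low c).
Proof. by apply: SL2_mx22; rewrite mul0r subr0 mulr1. Qed.

Lemma cvg_low c : low (c * t) @[t --> (0 : R)^'] --> (1%:M : 'M[R]_2).
Proof.
have ct : c * t @[t --> (0 : R)^'] --> (0 : R).
  rewrite -[X in _ --> X](mulr0 c); apply: cvgMl_tmp; exact: nbhs_dnbhs.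
apply: cvg_mxP => i j; rewrite mx22_1.
case: (ord2P i) => ->; case: (ord2P j) => ->; rewrite mxE /=;
  under eq_fun do rewrite mxE /=; by [exact: cvg_cst|exact: ct].
Qed.

Section FixedVector.
Variable v : V.
Hypothesis vE : forall t, U (expmx (t *: E)) v = v.
Let f g := ip (U g v) v.

Let f_bi g x y : SL2 g -> f (expmx (x *: E) *m g *m expmx (y *: E)) = f g.
Proof.
move=> gS; have oE := one_param_slE R.
rewrite /f (urepM HU) ?vE; [|apply: SL2M => //|]; try exact: op_SL2.
by rewrite (urepM HU) // ?(rep_adj HU) ?vE //; exact: op_SL2.
Qed.

(** By the Bruhat decomposition g = n w n' with n and n' upper unipotent and w
    depending only on the lower left entry of g, and f is invariant under n
    and n'. *)
Let f_lower_left g g' : SL2 g -> SL2 g' -> g iE iH != 0 -> g iE iH = g' iE iH ->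
  f g = f g'.
Proof.
pose w c := mx22 0 (- c^-1) c 0.
have fw k : SL2 k -> k iE iH != 0 -> f k = f (w (k iE iH)).
  move=> kS k0; set c := k iE iH in k0 *.
  have wS : SL2 (w c) by apply: SL2_mx22; rewrite mulr0 sub0r mulNr opprK mulVf.
  rewrite -(f_bi (2 * (k iH iH / c)) (2 * (k iE iE / c)) wS); congr f.
  have two y : 2 * y / 2 = y by rewrite mulrAC divff ?mul1r.
  rewrite !expmx_slE !two !mul_mx22 [LHS]mx22_eta -/c.
  have kd := SL2E kS; rewrite -/c in kd.
  have kb : k iH iE = (k iH iH * k iE iE - 1) / c.
    by apply: (mulIf k0); rewrite divfK // -kd; ring.
  by congr mx22; rewrite ?kb; field.
by move=> gS g'S g0 e; rewrite (fw g) // (fw g') -?e.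
Qed.

Let f_cvg g c : SL2 g -> (f (g *m low (c * t)) : R[i]^o) @[t --> (0 : R)^'] --> (f g : R[i]^o).
Proof.
move=> gS; rewrite /f; apply: (cvg_ipl Hip).
rewrite -[X in _ --> U X _]mulmx1; apply: rep_curve_cvg.
- by move=> t; apply: SL2M => //; exact: low_SL2.
- by rewrite mulmx1.
- by apply: cvg_mulmx; [exact: cvg_cst|exact: cvg_low].
Qed.

Let f_low_cvg c : (f (low (c * t)) : R[i]^o) @[t --> (0 : R)^'] --> (f 1%:M : R[i]^o).
Proof. by have := @f_cvg _ c (SL2_1 R); under eq_fun do rewrite mul1mx. Qed.

(** |U g v - v|^2 = 2 |v|^2 - 2 Re (f g). *)
Let f_fixed g : SL2 g -> f g = f 1%:M -> U g v = v.
Proof.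
move=> gS fg; apply/eqP; rewrite -subr_eq0; apply/eqP/(ip_eq0 Hip).
rewrite (ipBl Hip) !(ipBr Hip) (urep_unitary HU) // (ip_conj Hip (U g v) v).
rewrite -[ip (U g v) v]/(f g) fg /f (urep1 HU) -(ip_conj Hip); ring.
Qed.

(** The Mautner phenomenon.  The matrix coefficient f g = <U g v, v> depends
    only on the lower left entry c of g when c is nonzero.  An upper triangular
    k is the limit of matrices k n^- whose lower left entries tend to 0, and so
    is 1; hence f k = f 1 and k fixes v.  Multiplying by diagonal matrices then
    makes f independent of c, and the limit c -> 0 shows f = f 1 everywhere. *)
Lemma fixed_by_SL2 g : SL2 g -> U g v = v.
Proof.
have up k : SL2 k -> k iE iH = 0 -> U k v = v.
  move=> kS k0; apply: f_fixed => //.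
  have d0 : k iE iE != 0.
    by apply/eqP => d0; move/eqP: (SL2E kS); rewrite d0 k0 !mulr0 subrr eq_sym oner_eq0.
  have c1 := @f_cvg k 1 kS; have c2 := @f_low_cvg (k iE iE).
  suff c3 : (f (k *m low (1 * t)) : R[i]^o) @[t --> (0 : R)^'] --> (f 1%:M : R[i]^o).
    exact: (cvg_unique _ c1 c3).
  apply: cvg_trans c2; apply: near_eq_cvg; near=> t.
  have t0 : t != 0 by near: t; exact: nbhs_dnbhs_neq.
  apply: f_lower_left; [exact: low_SL2|by apply: SL2M => //; exact: low_SL2| |].
    by rewrite mxE /= mulf_neq0.
  by rewrite [k in RHS]mx22_eta mul_mx22 !mxE /= k0 mul0r add0r mul1r.
move=> gS; have [g0|g0] := eqVneq (g iE iH) 0; first exact: up.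
apply: f_fixed => //; set c := g iE iH in g0.
have c1 := @f_low_cvg c.
have c2 : (f (low (c * t)) : R[i]^o) @[t --> (0 : R)^'] --> (f g : R[i]^o).
  have : (f g : R[i]^o) @[_ --> (0 : R)^'] --> (f g : R[i]^o) by exact: cvg_cst.
  apply: cvg_trans; apply: near_eq_cvg; near=> t.
  have t0 : t != 0 by near: t; exact: nbhs_dnbhs_neq.
  have dS : SL2 (mx22 t 0 0 t^-1) by apply: SL2_mx22; rewrite mul0r subr0 divff.
  have -> : f g = f (g *m mx22 t 0 0 t^-1).
    by rewrite /f (urepM HU) // (up _ dS) // mxE.
  apply: esym; apply: f_lower_left; [exact: low_SL2|exact: SL2M| |].
    by rewrite mxE /= mulf_neq0.
  by rewrite [g in RHS]mx22_eta mul_mx22 !mxE /= mulr0 addr0.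
exact: (cvg_unique _ c2 c1).
Unshelve. all: by end_near. Qed.

End FixedVector.

(** Unitarity gives |U(exp tE) v - v| <= k |U(exp((t/k) E)) v - v|, and the right
    hand side tends to |t| |pi(E) v| = 0 as k grows. *)
Lemma unipotent_fixed v t : Cinf U v -> dU U E v = 0 -> U (expmx (t *: E)) v = v.
Proof.
move=> sv v0; have oE := one_param_slE R.
pose n s := nrm (U (expmx (s *: E)) v - v).
have nM s k : n (k%:R * s) <= k%:R * n s.
  elim: k => [|k IH].
    rewrite !mul0r /n scale0r -(scale0r E) expmx_slE mul0r -mx22_1.
    by rewrite (urep1 HU) subrr nrm0.
  rewrite -natr1 !mulrDl !mul1r /n expmx_slED (urepM HU); [|exact: op_SL2|exact: op_SL2].
  set g := expmx (_ *: E).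
  have gS : SL2 g by exact: op_SL2.
  have -> : U g (U (expmx (s *: E)) v) - v = (U g v - v) + U g (U (expmx (s *: E)) v - v).
    by rewrite (repB HU) // [RHS]addrC addrA subrK.
  by rewrite (le_trans (nrmD _ _)) // (nrm_rep Hip HU) // lerD.
have [->|t0] := eqVneq t 0; first by rewrite expmx_slE mul0r -mx22_1 (urep1 HU).
have nt0 : 0 < `|t| by rewrite normr_gt0.
apply/eqP; rewrite -subr_eq0; apply/eqP/nrm_eq0; apply/eqP.
rewrite eq_le nrm_ge0 andbT; apply/ler_addgt0Pr => e e0; rewrite add0r.
have := dU_cvg HU oE sv; rewrite v0 => /cvg_nrmP/cvgr0Pnorm_le/(_ (e / `|t|)).
rewrite divr_gt0 // => /(_ isT)/nbhs_ballP[d /= d0 dB].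
(* k is so large that t / k lies in the ball where the difference quotient is
   at most e / |t|. *)
pose k := (Num.bound (`|t| / d)).+1; pose s := t / k%:R.
have k0 : 0 < k%:R :> R by rewrite ltr0n.
have s0 : s != 0 by rewrite mulf_neq0 // invr_eq0 (gt_eqF k0).
have sd : `|s| < d.
  rewrite normrM normfV (gtr0_norm k0) ltr_pdivrMr // mulrC -ltr_pdivrMr //.
  rewrite (lt_trans (archi_boundP _)) ?divr_ge0 ?ltW // ltr_nat //.
have := dB s; rewrite -ball_normE /= sub0r normrN => /(_ sd s0).
rewrite subr0 ger0_norm ?nrm_ge0 // nrmZr -/(n s) => h.
have -> : t *: E = (k%:R * s) *: E by rewrite mulrC divfK // gt_eqF.
rewrite -/(n _) (le_trans (nM _ _)) //.
have -> : n s = `|s| * (`|s^-1| * n s) by rewrite mulrA -normrM divff // normr1 mul1r.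
have ks : k%:R = `|t| / `|s| :> R.
  rewrite normrM normfV (gtr0_norm k0); field.
  by rewrite (gt_eqF k0) (gt_eqF nt0).
rewrite ks [leLHS]mulrA divfK ?normr_eq0 //.
by rewrite mulrC -ler_pdivlMr.
Qed.

Lemma dU_slE_inj v : isotypic U 0 = [set 0] -> Cinf U v -> dU U E v = 0 -> v = 0.
Proof.
move=> iso sv v0; suff : isotypic U 0 v by rewrite iso.
move=> t /=; rewrite mul0r cos0 sin0 scale1r.
apply: fixed_by_SL2 => [s|]; first exact: unipotent_fixed.
exact: op_SL2 (one_param_soK R) t.
Qed.

End Relations.

(** * The vector of lowest K-type *)

Section LowestWeight.
Variables (R : realType) (V : completeNormedModType R[i]) (ip : V -> V -> R[i]).
Variable U : 'M[R]_2 -> V -> V.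
Hypotheses (Hip : inner_product ip) (HU : unitary_rep ip U).
Variables (k : int) (h : V).
Hypotheses (k_sqr : k * k = 1) (h_Cinf : Cinf U h) (h_type : isotypic U k h).
Implicit Types (t : R) (X : 'M[R]_2).
Local Notation q := (k%:~R : R).
Local Notation K t := (expmx (t *: soK R)).
Local Notation cis t := ((cos (q * t) +i* sin (q * t))%C : R[i]).

Let K_SL2 t : SL2 (K t). Proof. exact: (op_SL2 (one_param_soK R)). Qed.

Lemma dU_weight : dU U (soK R) h = (0 +i* q)%C *: h.
Proof.
apply: (dU_lim HU (one_param_soK R)) => //.
suff c : (((t^-1)%:C * (cis t - 1)) : R[i]^o) @[t --> (0 : R)^'] --> ((0 +i* q)%C : R[i]^o).
  apply: cvg_trans (cvgZr_tmp (a := h) c); apply: near_eq_cvg; near=> t.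
  by rewrite h_type -scalerA scalerBl scale1r.
have d : is_derive (0 : R) (1 : R) (fun t => sin (t * q)) (1 * q).
  by apply: is_derive_scaled; apply: is_derive_eq; exact: cos0.
have d' : is_derive (0 : R) (1 : R) (fun t => cos (t * q)) (- 0 * q).
  by apply: is_derive_scaled; apply: is_derive_eq; rewrite sin0.
have cs := derive_quotient d; have cc := derive_quotient d'.
rewrite mul0r sin0 mul1r in cs; rewrite mul0r cos0 oppr0 mul0r in cc.
apply: cvg_complexP => /=.
  apply: cvg_trans cc; apply: near_eq_cvg; near=> t => /=.
  by rewrite mul0r subr0 (mulrC q).
apply: cvg_trans cs; apply: near_eq_cvg; near=> t => /=.
by rewrite !(mul0r, subr0, addr0, add0r) (mulrC q).
Unshelve. all: by end_near. Qed.

(** Conjugating curves by exp(tK) gives U(exp tK) pi(X) h = pi(Ad(exp tK) X)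
    U(exp tK) h, and h is an eigenvector of U(exp tK). *)
Lemma rep_lin (D : 'I_2 -> 'I_2 -> V) X t :
  (forall (gam : R -> 'M[R]_2) Y, (forall t, SL2 (gam t)) -> tangent gam 1%:M Y ->
     (t^-1)%:C *: (U (gam t) h - h) @[t --> 0^'] --> lin D Y) ->
  one_param X ->
  U (K t) (lin D X) = cis t *: lin D (K t *m X *m K (- t)).
Proof.
move=> dD oX; have tS := K_SL2 t; have mS := K_SL2 (- t).
have KK : K t *m K (- t) = 1%:M by exact: (op_inv (one_param_soK R)).
have KK' : K (- t) *m K t = 1%:M by exact: mulmx1C.
have cS x : SL2 (K t *m expmx (x *: X) *m K (- t)).
  by do 2!apply: SL2M => //; exact: (op_SL2 oX).
have tc : tangent (fun x => K t *m expmx (x *: X) *m K (- t)) 1%:M (K t *m X *m K (- t)).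
  rewrite -KK -[K t in X in tangent _ X]mulmx1; apply: tangent_mulr.
  by apply: tangent_mull; exact: (op_tangent oX).
suff c3 : U (K t) ((x^-1)%:C *: (U (expmx (x *: X)) h - h)) @[x --> 0^'] -->
    cis t *: lin D (K t *m X *m K (- t)) by exact: (cvg_unique _ (cvg_rep Hip HU tS (dD _ _ (op_SL2 oX) (op_tangent oX))) c3).
apply: cvg_trans (cvgZl_tmp (k := cis t : R[i]) (dD _ _ cS tc)).
apply: near_eq_cvg; near=> x => /=.
have xS : SL2 (expmx (x *: X)) by exact: (op_SL2 oX).
rewrite (repZ HU) // (repB HU) // scalerA mulrC -scalerA; congr (_ *: _).
rewrite scalerBr -h_type; congr (_ - _).
rewrite -(repZ HU) // -h_type -(urepM HU) // -(urepM HU) //.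
by rewrite -mulmxA KK' mulmx1.
Unshelve. all: by end_near. Qed.

(** With A = diag(1, -1) and J the symmetric permutation matrix, A - i k J has
    weight -k for Ad(SO(2)) because k^2 = 1.  So (A - i k J) h has K-type 0 and
    vanishes.  The formula follows from A = 2 sqrt 2 H, J = 4 E - 2 K and
    K h = i k h. *)
Lemma dU_lowest : isotypic U 0 = [set 0] ->
  dU U (slH R) h = ((Num.sqrt 2)^-1)%:C *: h + (0 +i* (q * Num.sqrt 2))%C *: dU U (slE R) h.
Proof.
move=> iso; have [D dD] := tangent_at1 HU h_Cinf.
have oE := one_param_slE R; have oH := one_param_slH R; have oK := one_param_soK R.
have dH : dU U (slH R) h = lin D (slH R).
  by apply: (dU_lim HU oH h_Cinf); exact: dD (op_SL2 oH) (op_tangent oH).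
have dE : dU U (slE R) h = lin D (slE R).
  by apply: (dU_lim HU oE h_Cinf); exact: dD (op_SL2 oE) (op_tangent oE).
have dK : lin D (soK R) = (0 +i* q)%C *: h.
  rewrite -dU_weight; apply: esym.
  by apply: (dU_lim HU oK h_Cinf); exact: dD (op_SL2 oK) (op_tangent oK).
pose A : 'M[R]_2 := mx22 1 0 0 (-1); pose J : 'M[R]_2 := mx22 0 1 1 0.
have s2 : Num.sqrt 2 != 0 :> R by rewrite gt_eqF // sqrtr_gt0.
have AE : A = (2 * Num.sqrt 2) *: slH R by rewrite /slH scalerA mulfV ?scale1r // mulf_neq0.
have JE : J = 4 *: slE R - 2 *: soK R.
  by rewrite /slE /soK; apply: mx2P; rewrite !mxE /=; field.
have qq : q * q = 1 by rewrite -intrM k_sqr.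
have KE t : K t = mx22 (cos (t / 2)) (sin (t / 2)) (- sin (t / 2)) (cos (t / 2)).
  exact: expmx_soK.
have KE' t : K (- t) = mx22 (cos (t / 2)) (- sin (t / 2)) (sin (t / 2)) (cos (t / 2)).
  by rewrite KE mulNr cosN sinN opprK.
have ct t : cos t = cos (t / 2) * cos (t / 2) - sin (t / 2) * sin (t / 2) :> R.
  by rewrite -cosD -splitr.
have st t : sin t = sin (t / 2) * cos (t / 2) + cos (t / 2) * sin (t / 2) :> R.
  by rewrite -sinD -splitr.
have KA t : K t *m A *m K (- t) = cos t *: A - sin t *: J.
  rewrite KE KE' /A /J !mul_mx22 (ct t) (st t).
  by apply: mx2P; rewrite !mxE /=; ring.
have KJ t : K t *m J *m K (- t) = sin t *: A + cos t *: J.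
  rewrite KE KE' /A /J !mul_mx22 (ct t) (st t).
  by apply: mx2P; rewrite !mxE /=; ring.
have lA : lin D A = (2 * Num.sqrt 2)%:C *: lin D (slH R) by rewrite AE linZ.
have lJ : lin D J = 4%:C *: lin D (slE R) - 2%:C *: lin D (soK R).
  by rewrite JE linB !linZ.
have UA t : U (K t) (lin D A) = cis t *: lin D (K t *m A *m K (- t)).
  rewrite lA (repZ HU) // (rep_lin _ dD oH) scalerA mulrC -scalerA -linZ.
  by rewrite scalemxAl scalemxAr -AE.
have UJ t : U (K t) (lin D J) = cis t *: lin D (K t *m J *m K (- t)).
  rewrite lJ (repB HU) // !(repZ HU) // (rep_lin _ dD oE) (rep_lin _ dD oK).
  rewrite scalerA mulrC -scalerA -linZ [2%:C *: _]scalerA [_ * cis t]mulrC -scalerA.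
  rewrite -[2%:C *: _]linZ -scalerBr -linB JE mulmxBr mulmxBl.
  by rewrite -!scalemxAr -!scalemxAl.
have ext u v : (forall w, ip u w = ip v w) -> u = v.
  by move=> uv; apply/eqP; rewrite -subr_eq0; apply/eqP/(ip_eq0 Hip); rewrite (ipBl Hip) uv subrr.
have cq t : cos (q * t) = cos t.
  have /orP[/eqP->|/eqP->] : (k == 1) || (k == -1) by move/eqP: k_sqr; rewrite -expr2 sqrf_eq1.
    by rewrite mul1r.
  by rewrite rmorphN1 mulN1r cosN.
have sq t : sin (q * t) = q * sin t.
  have /orP[/eqP->|/eqP->] : (k == 1) || (k == -1) by move/eqP: k_sqr; rewrite -expr2 sqrf_eq1.
    by rewrite !mul1r.
  by rewrite rmorphN1 !mulN1r sinN.
(* cis t * (cos t - i k sin t) = 1, read on the coefficients of A and of J. *)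
have e1 t : cis t * (cos t)%:C - (0 +i* q)%C * cis t * (sin t)%:C = 1.
  rewrite cq sq; apply/eqP; rewrite eq_complex /=; apply/andP; split; apply/eqP.
    transitivity (cos t ^+ 2 + (q * q) * sin t ^+ 2); first by ring.
    by rewrite qq mul1r cos2Dsin2.
  by ring.
have e2 t : cis t * (sin t)%:C + (0 +i* q)%C * cis t * (cos t)%:C = (0 +i* q)%C.
  rewrite cq sq; apply/eqP; rewrite eq_complex /=; apply/andP; split; apply/eqP.
    transitivity ((1 - q * q) * cos t * sin t); first by ring.
    by rewrite qq subrr !mul0r.
  transitivity (q * (cos t ^+ 2 + sin t ^+ 2)); first by ring.
  by rewrite cos2Dsin2 mulr1.
have w0 : lin D A - (0 +i* q)%C *: lin D J = 0.
  suff : isotypic U 0 (lin D A - (0 +i* q)%C *: lin D J) by rewrite iso.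
  move=> t /=; rewrite mul0r cos0 sin0 scale1r (repB HU) // (repZ HU) // UA UJ KA KJ.
  rewrite linB linD !linZ; apply: ext => w.
  rewrite !(ipBl Hip) !(ipZl Hip) !(ipBl Hip) !(ipDl Hip) !(ipZl Hip).
  set a := ip _ w; set b := ip _ w.
  transitivity ((cis t * (cos t)%:C - (0 +i* q)%C * cis t * (sin t)%:C) * a -
    (cis t * (sin t)%:C + (0 +i* q)%C * cis t * (cos t)%:C) * b); first by ring.
  by rewrite e1 e2 mul1r.
rewrite dH dE; apply: ext => w.
move/(congr1 (fun u => ip u w)): w0; rewrite lJ lA dK.
rewrite (ip0l Hip) !(ipBl Hip) !(ipZl Hip) !(ipBl Hip) !(ipZl Hip) (ipDl Hip) !(ipZl Hip).
set a := ip _ w; set b := ip _ w; set c := ip _ w => e.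
have ii : (0 +i* q)%C * (0 +i* q)%C = - 1 :> R[i].
  apply/eqP; rewrite eq_complex /=; apply/andP; split; apply/eqP.
    by rewrite mul0r sub0r qq.
  by rewrite mul0r mulr0 addr0 ?oppr0.
have -> : (0 +i* (q * Num.sqrt 2))%C = (0 +i* q)%C * (Num.sqrt 2)%:C :> R[i].
  apply/eqP; rewrite eq_complex /=; apply/andP; split; apply/eqP.
    by rewrite mul0r mulr0 subrr.
  by rewrite mul0r add0r.
move: e; rewrite rmorphM !rmorph_nat fmorphV /=; set j := (0 +i* q)%C in ii *.
set z := (Num.sqrt 2)%:C => e.
have z0 : z != 0 by rewrite fmorph_eq0.
have zz : z * z = 2%:R by rewrite /z -rmorphM -expr2 sqr_sqrtr ?ler0n // rmorph_nat.
apply: (mulfI z0); transitivity (((2%:R * z * a - j * (4%:R * b - 2%:R * (j * c)))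
    + 4%:R * j * b - 2%:R * (j * j) * c) / 2%:R).
  by field.
rewrite e ii; transitivity (c + j * (z * z) * b); first by rewrite zz; field.
by field.
Qed.

End LowestWeight.

(** * Coordinates on cochains *)

Section Coordinates.
Local Close Scope classical_set_scope.
Variable R : realType.
Local Notation r := ((Num.sqrt 2)^-1 : R).

(** The arguments are the coefficients of 1, theta_H, theta_E and
    theta_H theta_E. *)
Definition mkc (T : Type) (x0 xH xE x2 : T) : cochain T :=
  [ffun A : {set 'I_2} => if iH \in A then (if iE \in A then x2 else xH)
                          else (if iE \in A then xE else x0)].

Definition mkw (T : Type) (u v : T) : coeff T := [ffun j => if j == iH then u else v].

Lemma mkcE (T : Type) (x0 xH xE x2 : T) A : mkc x0 xH xE x2 A =
  if iH \in A then (if iE \in A then x2 else xH) else (if iE \in A then xE else x0).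
Proof. by rewrite ffunE. Qed.

Lemma mkwH (T : Type) (u v : T) : mkw u v iH = u.
Proof. by rewrite ffunE. Qed.

Lemma mkwE (T : Type) (u v : T) : mkw u v iE = v.
Proof. by rewrite ffunE. Qed.

Lemma coeffP (T : Type) (w w' : coeff T) : w iH = w' iH -> w iE = w' iE -> w = w'.
Proof. by move=> eH eE; apply/ffunP => j; case: (ord2P j) => ->. Qed.

Lemma mkw_eta (T : Type) (w : coeff T) : w = mkw (w iH) (w iE).
Proof. by apply: coeffP; rewrite ?mkwH ?mkwE. Qed.

(** This decides equality of subsets of {H, E} by computation on booleans. *)
Lemma set2_eq (A B : {set 'I_2}) :
  (A == B) = ((iH \in A) == (iH \in B)) && ((iE \in A) == (iE \in B)).
Proof.
apply/eqP/andP => [->|[/eqP eH /eqP eE]]; first by rewrite !eqxx.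
by apply/setP => i; case: (ord2P i) => ->.
Qed.

Lemma set_I2P (A : {set 'I_2}) : [\/ A = finset.set0, A = [set iH], A = [set iE] | A = [set: 'I_2]].
Proof.
case eH: (iH \in A); case eE: (iE \in A);
  [constructor 4|constructor 2|constructor 3|constructor 1];
  by apply/eqP; rewrite set2_eq eH eE !inE.
Qed.

Lemma cochainP (T : Type) (x y : cochain T) : x finset.set0 = y finset.set0 -> x [set iH] = y [set iH] ->
  x [set iE] = y [set iE] -> x [set: 'I_2] = y [set: 'I_2] -> x = y.
Proof. by move=> *; apply/ffunP => A; case: (set_I2P A) => ->. Qed.

Lemma mkc_eta (T : Type) (x : cochain T) :
  x = mkc (x finset.set0) (x [set iH]) (x [set iE]) (x [set: 'I_2]).
Proof. by apply: cochainP; rewrite mkcE !inE. Qed.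

Lemma sum_set2 (W : nmodType) (F : {set 'I_2} -> W) :
  \sum_B F B = F finset.set0 + F [set iH] + F [set iE] + F [set: 'I_2].
Proof.
rewrite -big_enum (perm_big [:: finset.set0; [set iH]; [set iE]; [set: 'I_2]]) /=.
  by rewrite !big_cons big_nil addr0 !addrA.
apply: uniq_perm; first exact: enum_uniq.
  by rewrite /= !inE !set2_eq !inE.
by move=> A; rewrite mem_enum !inE; case: (set_I2P A) => ->; rewrite eqxx ?orbT.
Qed.

Lemma sum2_cond (W : nmodType) (P : pred 'I_2) (F : 'I_2 -> W) :
  \sum_(i | P i) F i = (if P iH then F iH else 0) + (if P iE then F iE else 0).
Proof. by rewrite big_mkcond sum2. Qed.

Lemma possgnH (K : pzRingType) A : possgn K iH A = 1.
Proof. by rewrite /possgn (_ : [set j in A | _] = finset.set0) ?cards0 //; apply/setP => j; rewrite !inE ltn0 andbF. Qed.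

Lemma possgnE (K : pzRingType) A : possgn K iE A = if iH \in A then -1 else 1.
Proof.
rewrite /possgn (_ : [set j in A | _] = if iH \in A then [set iH] else finset.set0).
  by case: ifP => _; rewrite ?cards1 ?cards0.
by apply/setP => j; case: (ord2P j) => ->; case: ifP => h; rewrite !inE ?h ?andbF.
Qed.

Lemma brk_HE : brk (slH R) (slE R) = r *: slE R.
Proof.
rewrite /brk /slH /slE -!scalemxAl -!scalemxAr !mul_mx22.
have s2 : Num.sqrt 2 != 0 :> R by rewrite gt_eqF // sqrtr_gt0.
by apply: mx2P; rewrite !mxE /=; field.
Qed.

Lemma brk_EH : brk (slE R) (slH R) = - r *: slE R.
Proof. by rewrite /brk -opprB -/(brk _ _) brk_HE scaleNr. Qed.

Lemma brk_self (X : 'M[R]_2) : brk X X = 0.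
Proof. by rewrite /brk subrr. Qed.

Lemma theta_scale i (c : R) X : theta i (c *: X) = c * theta i X.
Proof. by rewrite /theta; case: ifP => _; rewrite mxE; ring. Qed.

Lemma theta0 i : theta i (0 : 'M[R]_2) = 0.
Proof. by rewrite -(scale0r (0 : 'M[R]_2)) theta_scale mul0r. Qed.

Lemma theta_slH i : theta i (slH R) = (i == iH)%:R.
Proof. exact: (theta_anb R i iH). Qed.

Lemma theta_slE i : theta i (slE R) = (i == iE)%:R.
Proof. exact: (theta_anb R i iE). Qed.

Lemma anbH : anb R iH = slH R. Proof. by []. Qed.
Lemma anbE : anb R iE = slE R. Proof. by []. Qed.

Lemma admH j k : adm (slH R) j k = if (j == iE) && (k == iE) then r%:C else 0.
Proof.
rewrite mxE; case: (ord2P k) => ->; rewrite ?anbH ?anbE ?brk_self ?theta0 ?andbF //.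
by rewrite brk_HE theta_scale theta_slE andbT; case: eqP => _; rewrite ?mulr1 ?mulr0.
Qed.

Lemma admE j k : adm (slE R) j k = if (j == iE) && (k == iH) then - r%:C else 0.
Proof.
rewrite mxE; case: (ord2P k) => ->; rewrite ?anbH ?anbE ?brk_self ?theta0 ?andbF //.
rewrite brk_EH theta_scale theta_slE andbT; case: eqP => _; rewrite ?mulr1 ?mulr0 //.
by rewrite rmorphN.
Qed.

Section Values.
Variable W : lmodType R[i].

Lemma intp_slH (x0 xH xE x2 : W) : intp (slH R) (mkc x0 xH xE x2) = mkc xH 0 x2 0.
Proof.
by apply: cochainP; rewrite ffunE sum2_cond !mkcE !theta_slH !possgnH !inE /=
  ?mul1r ?mul0r ?scale1r ?scale0r ?addr0.
Qed.

Lemma intp_slE (x0 xH xE x2 : W) : intp (slE R) (mkc x0 xH xE x2) = mkc xE (- x2) 0 0.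
Proof.
by apply: cochainP; rewrite ffunE sum2_cond !mkcE !theta_slE !possgnE !inE /=
  ?mul1r ?mul0r ?scale1r ?scaleN1r ?scale0r ?addr0 ?add0r.
Qed.

Lemma intp_scale (c : R) X (w : cochain W) : intp (c *: X) w = c%:C *: intp X w.
Proof.
apply/ffunP => A; rewrite !ffunE scaler_sumr; apply: eq_bigr => i _.
by rewrite theta_scale rmorphM scalerA mulrA.
Qed.

Lemma ceD_mkc (act : 'M[R]_2 -> W -> W) (x0 xH xE x2 : W) :
  ceD act (mkc x0 xH xE x2) =
  mkc 0 (act (slH R) x0) (act (slE R) x0)
    (act (slH R) xE - act (slE R) xH - r%:C *: xE).
Proof.
apply: cochainP; rewrite ffunE !sum2_cond !mkcE !inE /= ?andbF ?addr0 ?add0r //.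
- by rewrite possgnH scale1r.
- by rewrite possgnE !inE /= scale1r.
- rewrite !anbH !anbE possgnH !possgnE !inE /= brk_HE intp_scale intp_slE.
  by rewrite ffunE mkcE !inE /= mul1r !scale1r !scaleN1r.
Qed.

End Values.

Lemma dstar_mkc (a b c d : R[i]) :
  dstar (mkc a b c d : Lam R) = mkc 0 0 0 (- (r%:C * c)).
Proof. by rewrite /dstar ceD_mkc subrr sub0r. Qed.

Lemma extm_mkc (t : 'I_2 -> R[i]) (a b c d : R[i]) :
  extm t (mkc a b c d : Lam R) = mkc 0 (t iH * a) (t iE * a) (t iH * c - t iE * b).
Proof.
apply: cochainP; rewrite ffunE sum2_cond !mkcE !inE /= ?addr0 ?add0r //.
- by rewrite possgnH mulr1.
- by rewrite possgnE !inE mulr1.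
- by rewrite possgnH !possgnE !inE /= mulr1 mulrN1 mulNr.
Qed.

Lemma thetaA_mkc B : thetaA R B = mkc (B == finset.set0)%:R (B == [set iH])%:R
  (B == [set iE])%:R (B == [set: 'I_2])%:R.
Proof. by apply: cochainP; rewrite ffunE mkcE !inE eq_sym. Qed.

Lemma dstarT_mkc (a b c d : R[i]) :
  dstarT (mkc a b c d : Lam R) = mkc 0 0 (- (r%:C * d)) 0.
Proof.
apply: cochainP; rewrite ffunE sum_set2 thetaA_mkc dstar_mkc !mkcE !inE !set2_eq !inE /=.
all: by rewrite !(mul0r, mulr0, mulr1, addr0, add0r, oppr0, mulNr).
Qed.

Section Tensors.
Variable V : completeNormedModType R[i].
Implicit Types (f : V -> V) (m : 'M[R[i]]_2) (w : coeff V).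

(** The operator f (x) m on V (x) an. *)
Definition opm f m w : coeff V := [ffun j => \sum_k m j k *: f (w k)].

Lemma tensE (a : Lam R -> Lam R) f m (x : tcochain V) A :
  tens a f m x A = \sum_B (a (thetaA R B) A : R[i]) *: opm f m (x B).
Proof.
rewrite ffunE; apply/ffunP => j; rewrite ffunE sum_ffunE; apply: eq_bigr => B _.
by rewrite !ffunE scaler_sumr; apply: eq_bigr => k _; rewrite scalerA.
Qed.

Ltac tens_coord := apply: cochainP; rewrite tensE sum_set2 !thetaA_mkc.
Ltac tens_finish := rewrite !mkcE !inE /=; do ?rewrite set2_eq; rewrite ?inE /=;
  rewrite ?(mul0r, mulr0, mulr1, addr0, add0r, oppr0, mulNr, subr0, sub0r, scale0r,
    scale1r, scaleN1r, scaleNr, mulrN) //.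

Lemma tens_iLamH f m (x0 xH xE x2 : coeff V) :
  tens (iLam (slH R)) f m (mkc x0 xH xE x2) = mkc (opm f m xH) 0 (opm f m x2) 0.
Proof. by tens_coord; rewrite /iLam !intp_slH; tens_finish. Qed.

Lemma tens_iLamE f m (x0 xH xE x2 : coeff V) :
  tens (iLam (slE R)) f m (mkc x0 xH xE x2) = mkc (opm f m xE) (- opm f m x2) 0 0.
Proof. by tens_coord; rewrite /iLam !intp_slE; tens_finish. Qed.

Lemma tens_dstarT f m (x0 xH xE x2 : coeff V) :
  tens (@dstarT R) f m (mkc x0 xH xE x2) = mkc 0 0 (- (r%:C *: opm f m x2)) 0.
Proof. by tens_coord; rewrite !dstarT_mkc; tens_finish. Qed.

Lemma tens_extm_iLamE t f m (x0 xH xE x2 : coeff V) :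
  tens (extm t \o iLam (slE R)) f m (mkc x0 xH xE x2) =
  mkc 0 (t iH *: opm f m xE) (t iE *: opm f m xE) (t iE *: opm f m x2).
Proof. by tens_coord; rewrite /= /iLam !intp_slE !extm_mkc; tens_finish; rewrite ?opprK. Qed.

Lemma tens_top f m (x0 xH xE x2 : coeff V) :
  tens (extm (cov R iH) \o extm (cov R iE) \o iLam (slH R) \o iLam (slE R)) f m
    (mkc x0 xH xE x2) = mkc 0 0 0 (- opm f m x2).
Proof.
by tens_coord; rewrite /= /iLam !intp_slE !intp_slH !extm_mkc /cov /=; tens_finish.
Qed.

Lemma opm_mkw f m u v : opm f m (mkw u v) =
  mkw (m iH iH *: f u + m iH iE *: f v) (m iE iH *: f u + m iE iE *: f v).
Proof. by apply: coeffP; rewrite !ffunE sum2 mkwH mkwE. Qed.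

End Tensors.
End Coordinates.

(** * The operators d, delta and p in coordinates *)

Section CoordinateFormulas.
Variables (R : realType) (V : completeNormedModType R[i]) (U : 'M[R]_2 -> V -> V).
Variables (phi : V -> R[i]) (h : V).
Local Notation r := ((Num.sqrt 2)^-1%:C : R[i]).
Local Notation z := (sqrt2C R).
Local Notation H := (dU U (slH R)).
Local Notation E := (dU U (slE R)).
Local Notation S := (opS U).
Local Notation T := (opT U phi h).

Lemma mkcD (W : nmodType) (a b c d a' b' c' d' : W) :
  mkc a b c d + mkc a' b' c' d' = mkc (a + a') (b + b') (c + c') (d + d').
Proof. by apply: cochainP; rewrite !ffunE !inE. Qed.

Lemma mkcN (W : zmodType) (a b c d : W) : - mkc a b c d = mkc (- a) (- b) (- c) (- d).
Proof. by apply: cochainP; rewrite !ffunE !inE. Qed.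

Lemma mkcZ (W : lmodType R[i]) (t : R[i]) (a b c d : W) :
  t *: mkc a b c d = mkc (t *: a) (t *: b) (t *: c) (t *: d).
Proof. by apply: cochainP; rewrite !ffunE !inE. Qed.

Lemma mkwD (u v u' v' : V) : mkw u v + mkw u' v' = mkw (u + u') (v + v').
Proof. by apply: coeffP; rewrite !ffunE. Qed.

Lemma mkwN (u v : V) : - mkw u v = mkw (- u) (- v).
Proof. by apply: coeffP; rewrite !ffunE. Qed.

Lemma mkwZ (t : R[i]) (u v : V) : t *: mkw u v = mkw (t *: u) (t *: v).
Proof. by apply: coeffP; rewrite !ffunE. Qed.

Lemma mkw0 : 0 = mkw 0 0 :> coeff V.
Proof. by apply: coeffP; rewrite !ffunE. Qed.

(** The H and E parts of the coefficients of 1, theta_H, theta_E and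
    theta_H theta_E, in this order. *)
Definition mkcw (a b c d e f g k : V) : tcochain V :=
  mkc (mkw a b) (mkw c d) (mkw e f) (mkw g k).

Lemma mkcw_eta (x : tcochain V) : x = mkcw (x finset.set0 iH) (x finset.set0 iE)
  (x (finset.set1 iH) iH) (x (finset.set1 iH) iE)
  (x (finset.set1 iE) iH) (x (finset.set1 iE) iE)
  (x (finset.setTfor 'I_2) iH) (x (finset.setTfor 'I_2) iE).
Proof. by rewrite /mkcw -!mkw_eta -mkc_eta. Qed.

Lemma sqrt2_neq0 : z != 0.
Proof. by rewrite /sqrt2C fmorph_eq0 gt_eqF // sqrtr_gt0. Qed.

Lemma sqrt2_sqr : z * z = 2.
Proof. by rewrite /sqrt2C -rmorphM -expr2 sqr_sqrtr // rmorph_nat. Qed.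

Lemma rE : r = z^-1.
Proof. by rewrite fmorphV. Qed.

Lemma z_r : z * r = 1.
Proof. by rewrite rE mulfV // sqrt2_neq0. Qed.

Lemma two_r : 2 * r = z.
Proof. by rewrite -sqrt2_sqr -mulrA z_r mulr1. Qed.

Lemma dan_coord a b yH yE zH zE u v : dan U (mkcw a b yH yE zH zE u v) =
  mkcw 0 0 (H a) (H b + r *: b) (E a) (E b - r *: a)
    (H zH - E yH - r *: zH) (H zE - E yE + r *: yH).
Proof.
have aH (s t : V) : actW U (slH R) (mkw s t) = mkw (H s) (H t + r *: t).
  apply: coeffP; rewrite !ffunE sum2 !admH !mkwH !mkwE /=.
    by rewrite !scale0r !addr0.
  by rewrite scale0r add0r.
have aE (s t : V) : actW U (slE R) (mkw s t) = mkw (E s) (E t - r *: s).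
  apply: coeffP; rewrite !ffunE sum2 !admE !mkwH !mkwE /=.
    by rewrite !scale0r !addr0.
  by rewrite scale0r addr0 scaleNr.
rewrite /mkcw /dan ceD_mkc !aH !aE -mkw0 mkwZ !mkwN !mkwD; congr mkc; congr mkw.
by rewrite addrAC addrK opprB addrA addrAC.
Qed.

Lemma opm_admH f (u v : V) : opm f (adm (slH R)) (mkw u v) = mkw 0 (r *: f v).
Proof. by rewrite opm_mkw !admH /= !scale0r !add0r. Qed.

Lemma opm_admE f (u v : V) : opm f (adm (slE R)) (mkw u v) = mkw 0 (- r *: f u).
Proof. by rewrite opm_mkw !admE /= !scale0r !addr0. Qed.

(** 1 - sqrt 2 ad(H) is the projection onto R H along R E, because
    ad(H) E = E / sqrt 2. *)
Lemma opm_proj f (c : R[i]) (u v : V) :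
  opm f (1%:M - z *: adm (slH R) + c *: adm (slE R)) (mkw u v) =
  mkw (f u) (- (c * r) *: f u).
Proof.
have gen (A B : 'M[R[i]]_2) j k :
    (1%:M - z *: A + c *: B) j k = (j == k)%:R - z * A j k + c * B j k.
  by rewrite !mxE.
rewrite opm_mkw !gen !admH !admE /= !mulr0 z_r subrr !subr0 !addr0 !add0r.
by rewrite subrr !scale0r !addr0 scale1r mulrN.
Qed.

Lemma opm_proj0 f (u v : V) : opm f (1%:M - z *: adm (slH R)) (mkw u v) = mkw (f u) 0.
Proof.
rewrite -[1%:M - _]addr0 -(scale0r (adm (slE R))) opm_proj.
by rewrite mul0r oppr0 scale0r.
Qed.

Lemma opm_scale f (c : R[i]) m w : opm f (c *: m) w = c *: opm f m w :> coeff V.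
Proof.
apply/ffunP => j; rewrite !ffunE scaler_sumr; apply: eq_bigr => k _.
by rewrite mxE scalerA.
Qed.

Lemma mkcwD a b c d e f g k a' b' c' d' e' f' g' k' :
  mkcw a b c d e f g k + mkcw a' b' c' d' e' f' g' k' =
  mkcw (a + a') (b + b') (c + c') (d + d') (e + e') (f + f') (g + g') (k + k').
Proof. by rewrite /mkcw mkcD !mkwD. Qed.

Lemma mkcwN a b c d e f g k :
  - mkcw a b c d e f g k = mkcw (- a) (- b) (- c) (- d) (- e) (- f) (- g) (- k).
Proof. by rewrite /mkcw mkcN !mkwN. Qed.

Lemma mkcwZ (t : R[i]) a b c d e f g k : t *: mkcw a b c d e f g k =
  mkcw (t *: a) (t *: b) (t *: c) (t *: d) (t *: e) (t *: f) (t *: g) (t *: k).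
Proof. by rewrite /mkcw mkcZ !mkwZ. Qed.

Section Terms.
Variables (f : V -> V) (a b yH yE zH zE u v : V).
Local Notation x := (mkcw a b yH yE zH zE u v).

Lemma tens_dstarT_admE : tens (@dstarT R) f (adm (slE R)) x =
  mkcw 0 0 0 0 0 (r *: (r *: f u)) 0 0.
Proof.
rewrite /mkcw tens_dstarT opm_admE -mkw0 mkwZ mkwN.
by rewrite scaler0 oppr0 scaleNr scalerN opprK.
Qed.

Lemma tens_iLamH_admH : tens (iLam (slH R)) f (adm (slH R)) x =
  mkcw 0 (r *: f yE) 0 0 0 (r *: f v) 0 0.
Proof. by rewrite /mkcw tens_iLamH !opm_admH -mkw0. Qed.

Lemma tens_iLamE_admH : tens (iLam (slE R)) f (adm (slH R)) x =
  mkcw 0 (r *: f zE) 0 (- (r *: f v)) 0 0 0 0.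
Proof. by rewrite /mkcw tens_iLamE !opm_admH -mkw0 mkwN oppr0. Qed.

Lemma tens_iLamE_proj : tens (iLam (slE R)) f (1%:M - z *: adm (slH R)) x =
  mkcw (f zH) 0 (- f u) 0 0 0 0 0.
Proof. by rewrite /mkcw tens_iLamE !opm_proj0 -mkw0 mkwN oppr0. Qed.

Lemma tens_iLamE_admE : tens (iLam (slE R)) f (adm (slE R)) x =
  mkcw 0 (- (r *: f zH)) 0 (r *: f u) 0 0 0 0.
Proof. by rewrite /mkcw tens_iLamE !opm_admE -mkw0 mkwN oppr0 !scaleNr opprK. Qed.

Lemma tens_extm_proj t c :
  tens (extm t \o iLam (slE R)) f (1%:M - z *: adm (slH R) + c *: adm (slE R)) x =
  mkcw 0 0 (t iH *: f zH) (t iH *: (- (c * r) *: f zH))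
    (t iE *: f zH) (t iE *: (- (c * r) *: f zH))
    (t iE *: f u) (t iE *: (- (c * r) *: f u)).
Proof. by rewrite /mkcw tens_extm_iLamE !opm_proj -mkw0 !mkwZ. Qed.

Lemma tens_top_admE c :
  tens (extm (cov R iH) \o extm (cov R iE) \o iLam (slH R) \o iLam (slE R)) f
    (c *: adm (slE R)) x = mkcw 0 0 0 0 0 0 0 (c *: (r *: f u)).
Proof.
rewrite /mkcw tens_top opm_scale opm_admE -mkw0 mkwZ mkwN.
by rewrite scaler0 oppr0 scaleNr scalerN opprK.
Qed.

End Terms.

Lemma delta_coord a b yH yE zH zE u v :
  delta_op U phi h (mkcw a b yH yE zH zE u v) =
  mkcw (T zH) (z *: yE - z *: S zE - S (T zH))
       (- T u) (z *: S v + S (T u))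
       0 (T u + z *: v) 0 0.
Proof.
set x := mkcw _ _ _ _ _ _ _ _.
transitivity (2 *: mkcw 0 0 0 0 0 (r *: (r *: T u)) 0 0
  + 2 *: mkcw 0 (r *: yE) 0 0 0 (r *: v) 0 0
  - 2 *: mkcw 0 (r *: S zE) 0 (- (r *: S v)) 0 0 0 0
  + mkcw (T zH) 0 (- T u) 0 0 0 0 0
  + z *: mkcw 0 (- (r *: S (T zH))) 0 (r *: S (T u)) 0 0 0 0).
  have aux (A1 A2 A3 A4 A5 B1 B2 B3 B4 B5 : tcochain V) :
      A1 = B1 -> A2 = B2 -> A3 = B3 -> A4 = B4 -> A5 = B5 ->
      2 *: A1 + 2 *: A2 - 2 *: A3 + A4 + z *: A5 =
      2 *: B1 + 2 *: B2 - 2 *: B3 + B4 + z *: B5 by move=> -> -> -> -> ->.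
  exact: (aux _ _ _ _ _ _ _ _ _ _
    (tens_dstarT_admE T a b yH yE zH zE u v) (tens_iLamH_admH id a b yH yE zH zE u v)
    (tens_iLamE_admH S a b yH yE zH zE u v) (tens_iLamE_proj T a b yH yE zH zE u v)
    (tens_iLamE_admE (S \o T) a b yH yE zH zE u v)).
rewrite !mkcwZ !mkcwN !mkcwD !scaler0 !scalerN !scalerA !two_r z_r !scale1r.
by rewrite !oppr0 !(addr0, add0r) opprK.
Qed.

(** kap is \pm sqrt 2 i.  It also equals \pm 2 i times 1 / sqrt 2, the entry of
    - ad(E), and kap^2 = -2; hence the coefficients of p are powers of kap, up to sign. *)
Lemma p_coord neg (kap := (0 +i* ((sgz_of neg)%:~R * Num.sqrt 2))%C : R[i])
    a b yH yE zH zE u v :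
  p_op neg phi h (mkcw a b yH yE zH zE u v) =
  mkcw 0 0 (kap *: (phi zH *: h)) (2 *: (phi zH *: h))
    (phi zH *: h) (- kap *: (phi zH *: h)) (phi u *: h) 0.
Proof.
set x := mkcw _ _ _ _ _ _ _ _.
pose s : R[i] := (sgz_of neg)%:~R; pose I : R[i] := (0 +i* 1)%C.
have sE : s = ((sgz_of neg)%:~R : R)%:C by rewrite rmorph_int.
have II : I * I = -1.
  by apply/eqP; rewrite eq_complex /= !mul0r !mulr0 mulr1 sub0r addr0 ?oppr0 !eqxx.
have ss : s * s = 1.
  by rewrite /s -intrM /sgz_of -expr2 -exprM mulnC exprM sqrrN expr1n.
have kE : kap = s * z * I.
  rewrite sE; apply/eqP; rewrite eq_complex /=; apply/andP; split; apply/eqP; ring.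
have cr : s * 2 * I * r = kap by rewrite kE -two_r; ring.
have kk : kap * kap = - 2.
  rewrite kE (_ : _ * _ = (s * s) * (z * z) * (I * I)); last by ring.
  by rewrite ss sqrt2_sqr II; ring.
rewrite /p_op -/s -/I.
rewrite [X in X + _](tens_extm_proj (phih phi h) a b yH yE zH zE u v).
rewrite [X in _ + X](tens_top_admE (phih phi h) a b yH yE zH zE u v).
rewrite mkcwD /cov /phih /= cr !mulr0 !mulr1 !addr0 !add0r -kE !scale1r !scalerA cr.
by rewrite mulrN kk opprK -scalerDl -mulrDl addNr mul0r scale0r.
Qed.

End CoordinateFormulas.

(** * The homotopy identity *)

Definition linear_on (R : realType) (V : completeNormedModType R[i]) (C : set V)
    (f : V -> V) :=
  forall (a : R[i]) (u v : V), C u -> C v -> f (a *: u + v) = a *: f u + f v.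

(** The relations from which the homotopy identity follows, with C for the space
    of smooth vectors, r = 1 / sqrt 2 and kap = \pm sqrt 2 i. *)
Record an_splitting (R : realType) (V : completeNormedModType R[i]) (C : set V)
    (H E S T : V -> V) (phi : V -> R[i]) (h : V) (kap : R[i])
    (r := (Num.sqrt 2)^-1%:C : R[i]) : Prop := AnSplitting {
  an_C0 : C 0 ;
  an_comb : forall (a : R[i]) (u v : V), C u -> C v -> C (a *: u + v) ;
  an_CH : forall v, C v -> C (H v) ;
  an_CE : forall v, C v -> C (E v) ;
  an_H_lin : linear_on C H ;
  an_E_lin : linear_on C E ;
  an_E_inj : forall v, C v -> E v = 0 -> v = 0 ;
  an_bracket : forall v, C v -> H (E v) = E (H v) + r *: E v ;
  an_phi_lin : forall (a : R[i]) (u v : V), C u -> C v -> phi (a *: u + v) = a * phi u + phi v ;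
  an_phiE : forall v, C v -> phi (E v) = 0 ;
  an_phiH : forall v, C v -> phi (H v) = r * phi v ;
  an_Ch : C h ;
  an_phih : phi h = 1 ;
  an_kap : kap * kap = - 2 ;
  an_lowest : H h = r *: h + kap *: E h ;
  an_CS : forall v, C v -> C (S v) ;
  an_CT : forall v, C v -> C (T v) ;
  an_ES : forall v, C v -> E (S v) = H v - r *: v ;
  an_ET : forall v, C v -> E (T v) = v - phi v *: h }.

Section Homotopy.
Variables (R : realType) (V : completeNormedModType R[i]) (ip : V -> V -> R[i]).
Hypothesis Hip : inner_product ip.
Variables (C : set V) (H E S T : V -> V) (phi : V -> R[i]) (h : V) (kap : R[i]).
Hypothesis Han : an_splitting C H E S T phi h kap.
Local Notation z := (sqrt2C R).
Local Notation r := ((Num.sqrt 2)^-1%:C : R[i]).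
Implicit Types (u v w : V) (a : R[i]).

Let C0 := an_C0 Han.
Let C_comb := an_comb Han.
Let CH := an_CH Han.
Let CE := an_CE Han.
Let H_lin := an_H_lin Han.
Let E_lin := an_E_lin Han.
Let E_inj := an_E_inj Han.
Let bracket := an_bracket Han.
Let phi_lin := an_phi_lin Han.
Let phiE := an_phiE Han.
Let phiH := an_phiH Han.
Let Ch := an_Ch Han.
Let phih1 := an_phih Han.
Let kap_sqr := an_kap Han.
Let lowest := an_lowest Han.
Let CS := an_CS Han.
Let CT := an_CT Han.
Let ES := an_ES Han.
Let ET := an_ET Han.

Let CZ a v : C v -> C (a *: v).
Proof. by move=> Cv; rewrite -[_ *: _]addr0; exact: C_comb. Qed.

Let CD u v : C u -> C v -> C (u + v).
Proof. by move=> Cu Cv; rewrite -[u]scale1r; exact: C_comb. Qed.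

Let CN v : C v -> C (- v).
Proof. by move=> Cv; rewrite -scaleN1r; exact: CZ. Qed.

(** Pairing with w turns an identity between linear combinations of vectors into
    a scalar identity, within reach of the ring and field tactics. *)
Lemma ip_ext u v : (forall w, ip u w = ip v w) -> u = v.
Proof.
move=> uv; apply/eqP; rewrite -subr_eq0; apply/eqP/(ip_eq0 Hip).
by rewrite (ipBl Hip) uv subrr.
Qed.

Section LinearOn.
Variable f : V -> V.
Hypothesis f_lin : linear_on C f.

Lemma lin_on0 : f 0 = 0.
Proof. by have := f_lin (-1) C0 C0; rewrite scaler0 addr0 scaleN1r addNr. Qed.

Lemma lin_onZ a v : C v -> f (a *: v) = a *: f v.
Proof. by move=> Cv; have := f_lin a Cv C0; rewrite !addr0 lin_on0 addr0. Qed.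

Lemma lin_onD u v : C u -> C v -> f (u + v) = f u + f v.
Proof. by move=> Cu Cv; have := f_lin 1 Cu Cv; rewrite !scale1r. Qed.

Lemma lin_onN v : C v -> f (- v) = - f v.
Proof. by move=> Cv; rewrite -scaleN1r lin_onZ // scaleN1r. Qed.

Lemma lin_onB u v : C u -> C v -> f (u - v) = f u - f v.
Proof. by move=> Cu Cv; rewrite lin_onD ?lin_onN //; exact: CN. Qed.

End LinearOn.

(** The relations between S, T and H are proved by cancelling E. *)
Lemma E_cancel u v : C u -> C v -> E u = E v -> u = v.
Proof.
move=> Cu Cv e; apply/eqP; rewrite -subr_eq0; apply/eqP/E_inj.
  by apply: CD => //; exact: CN.
by rewrite (lin_onB E_lin) // e subrr.
Qed.

Lemma phi0 : phi 0 = 0.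
Proof. by have := phi_lin (-1) C0 C0; rewrite scaler0 addr0 mulN1r addNr. Qed.

Lemma phiZ a v : C v -> phi (a *: v) = a * phi v.
Proof. by move=> Cv; have := phi_lin a Cv C0; rewrite !addr0 phi0 addr0. Qed.

Lemma phiD u v : C u -> C v -> phi (u + v) = phi u + phi v.
Proof. by move=> Cu Cv; have := phi_lin 1 Cu Cv; rewrite scale1r mul1r. Qed.

Lemma phiB u v : C u -> C v -> phi (u - v) = phi u - phi v.
Proof.
by move=> Cu Cv; rewrite -[- v]scaleN1r phiD ?phiZ ?mulN1r //; exact: CZ.
Qed.

Ltac inC := repeat first [ assumption | exact: C0 | apply: CD | apply: CN | apply: CZ
  | apply: CH | apply: CE | apply: CS | apply: CT ].
Ltac by_coefficients := apply: ip_ext => ?;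
  rewrite ?(ipDl Hip, ipNl Hip, ipZl Hip, ip0l Hip).

Lemma S_lin : linear_on C S.
Proof.
move=> a u v Cu Cv; apply: E_cancel; [by inC|by inC|].
rewrite E_lin ?ES ?H_lin //; try by inC.
by by_coefficients; ring.
Qed.

Lemma T_lin : linear_on C T.
Proof.
move=> a u v Cu Cv; apply: E_cancel; [by inC|by inC|].
rewrite E_lin ?ET ?phi_lin //; try by inC.
by by_coefficients; ring.
Qed.

Lemma SE v : C v -> S (E v) = H v.
Proof.
move=> Cv; apply: E_cancel; [by inC|by inC|].
by rewrite ES ?bracket ?addrK //; inC.
Qed.

Lemma TE v : C v -> T (E v) = v.
Proof.
move=> Cv; apply: E_cancel; [by inC|by inC|].
by rewrite ET ?phiE ?scale0r ?subr0 //; inC.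
Qed.

Lemma HS v : C v -> H (S v) = S (H v) - r *: S v.
Proof.
move=> Cv; apply: E_cancel; [by inC|by inC|].
rewrite (lin_onB E_lin) ?(lin_onZ E_lin) ?ES; try by inC.
have := bracket (CS Cv); rewrite ES // (lin_onB H_lin) ?(lin_onZ H_lin); try by inC.
move=> e; rewrite -[LHS](addrK (r *: (H v - r *: v))) -e.
by by_coefficients; ring.
Qed.

Lemma Sh : S h = kap *: h.
Proof.
apply: E_cancel; [by inC|by inC|].
by rewrite ES // (lin_onZ E_lin) // lowest addrAC subrr add0r.
Qed.

Lemma Th : T h = 0.
Proof.
apply: E_cancel; [by inC|by inC|].
by rewrite ET // phih1 scale1r subrr (lin_on0 E_lin).
Qed.

(** Commuting H past 1 - phi h produces, up to sign, phi v *: (H h - r *: h), which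
    is kap * phi v *: E h; cancelling E leaves the last term. *)
Lemma HT v : C v -> H (T v) = T (H v) - r *: T v - (kap * phi v) *: h.
Proof.
move=> Cv; apply: E_cancel; [by inC|by inC|].
rewrite !(lin_onB E_lin) ?(lin_onZ E_lin) ?ET; try by inC.
have := bracket (CT Cv); rewrite ET // (lin_onB H_lin) ?(lin_onZ H_lin); try by inC.
rewrite lowest phiH // => e; rewrite -[LHS](addrK (r *: (v - phi v *: h))) -e.
by by_coefficients; ring.
Qed.

Local Notation T4 := (tcochain V).
Implicit Types x : T4.

Definition in_C x := forall A j, C (x A j).

Definition dC (a b yH yE zH zE u v : V) : T4 :=
  mkcw 0 0 (H a) (H b + r *: b) (E a) (E b - r *: a)
    (H zH - E yH - r *: zH) (H zE - E yE + r *: yH).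
Definition deltaC (a b yH yE zH zE u v : V) : T4 :=
  mkcw (T zH) (z *: yE - z *: S zE - S (T zH))
       (- T u) (z *: S v + S (T u)) 0 (T u + z *: v) 0 0.
Definition pC (a b yH yE zH zE u v : V) : T4 :=
  mkcw 0 0 (kap *: (phi zH *: h)) (2 *: (phi zH *: h))
    (phi zH *: h) (- kap *: (phi zH *: h)) (phi u *: h) 0.

Definition coordinates (f : T4 -> T4) (F : V -> V -> V -> V -> V -> V -> V -> V -> T4) :=
  forall (a b yH yE zH zE u v : V), f (mkcw a b yH yE zH zE u v) = F a b yH yE zH zE u v.

Variables (d delta p : T4 -> T4).
Hypotheses (dE : coordinates d dC) (deltaE : coordinates delta deltaC)
  (pE : coordinates p pC).

Lemma in_C_mkcw (a b yH yE zH zE u v : V) :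
  in_C (mkcw a b yH yE zH zE u v) <->
  [/\ [/\ C a, C b, C yH & C yE] & [/\ C zH, C zE, C u & C v]].
Proof.
split=> [c|[[? ? ? ?] [? ? ? ?]] A j]; last first.
  by rewrite /mkcw mkcE; case: ifP => _; case: ifP => _;
    case: (ord2P j) => ->; rewrite ?mkwH ?mkwE.
have q A j := c A j.
by do !split;
 [move: (q finset.set0 iH)|move: (q finset.set0 iE)|move: (q (finset.set1 iH) iH)
 |move: (q (finset.set1 iH) iE)|move: (q (finset.set1 iE) iH)|move: (q (finset.set1 iE) iE)
 |move: (q (finset.setTfor 'I_2) iH)|move: (q (finset.setTfor 'I_2) iE)];
 rewrite /mkcw mkcE !inE /= ?mkwH ?mkwE.
Qed.

Lemma mkcwP (a b c e f g k l a' b' c' e' f' g' k' l' : V) :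
  a = a' -> b = b' -> c = c' -> e = e' -> f = f' -> g = g' -> k = k' -> l = l' ->
  mkcw a b c e f g k l = mkcw a' b' c' e' f' g' k' l' :> T4.
Proof. by do 8!move=> ->. Qed.

Lemma tcochain_ind (P : T4 -> Prop) :
  (forall (a b yH yE zH zE u v : V), C a -> C b -> C yH -> C yE -> C zH -> C zE -> C u -> C v ->
     P (mkcw a b yH yE zH zE u v)) -> forall x, in_C x -> P x.
Proof.
move=> hP x; rewrite (mkcw_eta x) => /in_C_mkcw[[? ? ? ?] [? ? ? ?]]; exact: hP.
Qed.

Lemma mkcw0 : 0 = mkcw 0 0 0 0 0 0 0 0 :> T4.
Proof. by rewrite /mkcw -!mkw0; apply: cochainP; rewrite mkcE !ffunE !inE. Qed.

Lemma d_in_C x : in_C x -> in_C (d x).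
Proof.
move: x; apply: tcochain_ind => *; rewrite dE; apply/in_C_mkcw; do !split; inC.
Qed.

Lemma delta_in_C x : in_C x -> in_C (delta x).
Proof.
move: x; apply: tcochain_ind => *; rewrite deltaE; apply/in_C_mkcw; do !split; inC.
Qed.

Lemma p_in_C x : in_C x -> in_C (p x).
Proof.
move: x; apply: tcochain_ind => *; rewrite pE; apply/in_C_mkcw; do !split; inC.
Qed.

(* The words in H, E, S and T are brought to a normal form: E cancels against S
   and T, and H moves to the right of E, S and T. *)
Ltac expand := repeat first
 [ rewrite (lin_onD H_lin); [|by inC|by inC] | rewrite (lin_onN H_lin); [|by inC]
 | rewrite (lin_onZ H_lin); [|by inC] | rewrite (lin_on0 H_lin)
 | rewrite (lin_onD E_lin); [|by inC|by inC] | rewrite (lin_onN E_lin); [|by inC]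
 | rewrite (lin_onZ E_lin); [|by inC] | rewrite (lin_on0 E_lin)
 | rewrite (lin_onD S_lin); [|by inC|by inC] | rewrite (lin_onN S_lin); [|by inC]
 | rewrite (lin_onZ S_lin); [|by inC] | rewrite (lin_on0 S_lin)
 | rewrite (lin_onD T_lin); [|by inC|by inC] | rewrite (lin_onN T_lin); [|by inC]
 | rewrite (lin_onZ T_lin); [|by inC] | rewrite (lin_on0 T_lin)
 | rewrite ES; [|by inC] | rewrite ET; [|by inC] | rewrite SE; [|by inC]
 | rewrite TE; [|by inC] | rewrite HS; [|by inC] | rewrite HT; [|by inC]
 | rewrite bracket; [|by inC] | rewrite lowest | rewrite Sh | rewrite Th ].

Let z0 : z != 0. Proof. exact: sqrt2_neq0. Qed.
Let r_z : r = z^-1. Proof. exact: rE. Qed.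
Let two : 2 = - (kap * kap). Proof. by rewrite kap_sqr opprK. Qed.

Lemma d_d x : in_C x -> d (d x) = 0.
Proof.
move: x; apply: tcochain_ind => a b yH yE zH zE u v *; rewrite !dE mkcw0; apply: mkcwP.
all: expand; by_coefficients; by ring.
Qed.

Lemma delta_delta x : in_C x -> delta (delta x) = 0.
Proof.
move: x; apply: tcochain_ind => a b yH yE zH zE u v *; rewrite !deltaE mkcw0; apply: mkcwP.
all: expand; by_coefficients; by ring.
Qed.

Ltac scalar_identity := rewrite ?r_z; first
  [ by ring | by field | by rewrite two; ring | by rewrite two; field ].

Lemma d_p x : in_C x -> d (p x) = 0.
Proof.
move: x; apply: tcochain_ind => a b yH yE zH zE u v *; rewrite pE dE mkcw0; apply: mkcwP.
all: expand; by_coefficients; scalar_identity.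
Qed.

Lemma delta_p x : in_C x -> delta (p x) = 0.
Proof.
move: x; apply: tcochain_ind => a b yH yE zH zE u v *; rewrite pE deltaE mkcw0; apply: mkcwP.
all: expand; by_coefficients; scalar_identity.
Qed.

Lemma p_d x : in_C x -> p (d x) = 0.
Proof.
move: x; apply: tcochain_ind => a b yH yE zH zE u v *; rewrite dE pE /pC mkcw0.
have -> : phi (H zH - E yH - r *: zH) = 0.
  rewrite !phiB ?phiZ ?phiH ?phiE ?subr0 ?subrr //; by inC.
by rewrite phiE // !scale0r !scaler0.
Qed.

Lemma p_delta x : in_C x -> p (delta x) = 0.
Proof.
move: x; apply: tcochain_ind => *; rewrite deltaE pE /pC mkcw0.
by rewrite phi0 !scale0r !scaler0.
Qed.

(** The summand p x collects the terms with phi that [ET] and [HT] leave over. *)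
Lemma homotopy x : in_C x -> x = p x + d (delta x) + delta (d x).
Proof.
move: x; apply: tcochain_ind => a b yH yE zH zE u v *.
rewrite pE deltaE !dE deltaE /pC /dC /deltaC !mkcwD; apply: mkcwP.
all: expand; by_coefficients; scalar_identity.
Qed.

Definition linear_on_C (f : T4 -> T4) := forall (c : R[i]) x y, in_C x -> in_C y ->
  f (c *: x + y) = c *: f x + f y.

Lemma d_lin : linear_on_C d.
Proof.
move=> c x y; move: x; apply: tcochain_ind => a b yH yE zH zE u v ? ? ? ? ? ? ? ?.
move: y; apply: tcochain_ind => *; rewrite mkcwZ mkcwD !dE /dC mkcwZ mkcwD; apply: mkcwP.
all: expand; by_coefficients; by ring.
Qed.

Lemma delta_lin : linear_on_C delta.
Proof.
move=> c x y; move: x; apply: tcochain_ind => a b yH yE zH zE u v ? ? ? ? ? ? ? ?.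
move: y; apply: tcochain_ind => *; rewrite mkcwZ mkcwD !deltaE /deltaC mkcwZ mkcwD; apply: mkcwP.
all: expand; by_coefficients; by ring.
Qed.

Lemma p_lin : linear_on_C p.
Proof.
move=> c x y; move: x; apply: tcochain_ind => a b yH yE zH zE u v ? ? ? ? ? ? ? ?.
move: y; apply: tcochain_ind => *; rewrite mkcwZ mkcwD !pE /pC mkcwZ mkcwD !phi_lin //.
by apply: mkcwP; by_coefficients; ring.
Qed.

Lemma p_homog n x : in_C x -> homog n x -> homog n (p x).
Proof.
move: x; apply: tcochain_ind => a b yH yE zH zE u v ? ? ? ? ? ? ? ? hx A.
rewrite pE /pC /mkcw mkcE.
have key (s t : V) : mkw s t = 0 -> s = 0.
  by move=> /(congr1 (fun w : coeff V => w iH)); rewrite mkwH ffunE.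
case: (set_I2P A) => ->; rewrite !inE /= => An; first by rewrite -mkw0.
- have /key -> : mkw zH zE = 0.
    have An' : #|finset.set1 iE| != n by move: An; rewrite !cards1.
    by have := hx _ An'; rewrite /mkcw mkcE !inE.
  by rewrite phi0 !scale0r !scaler0 -mkw0.
- have /key -> : mkw zH zE = 0 by have := hx _ An; rewrite /mkcw mkcE !inE.
  by rewrite phi0 !scale0r !scaler0 -mkw0.
- have /key -> : mkw u v = 0 by have := hx _ An; rewrite /mkcw mkcE !inE.
  by rewrite phi0 !scale0r -mkw0.
Qed.

End Homotopy.

(** * Decompositions produced by a homotopy *)

(** A homotopy between the identity and p for which delta also squares to 0; this
    is what makes d and delta play symmetric parts. *)
Record hodge_data (K : nzRingType) (M : lmodType K) (C : set M) (d delta p : M -> M)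
    (lin := fun f : M -> M => forall (t : K) (x y : M),
       C x -> C y -> f (t *: x + y) = t *: f x + f y) : Prop := HodgeData {
  hodge_C0 : C 0 ;
  hodge_comb : forall (t : K) (x y : M), C x -> C y -> C (t *: x + y) ;
  hodge_Cd : forall x, C x -> C (d x) ;
  hodge_Cdelta : forall x, C x -> C (delta x) ;
  hodge_Cp : forall x, C x -> C (p x) ;
  hodge_d_lin : lin d ;
  hodge_delta_lin : lin delta ;
  hodge_p_lin : lin p ;
  hodge_dd : forall x, C x -> d (d x) = 0 ;
  hodge_deltadelta : forall x, C x -> delta (delta x) = 0 ;
  hodge_dp : forall x, C x -> d (p x) = 0 ;
  hodge_pd : forall x, C x -> p (d x) = 0 ;
  hodge_deltap : forall x, C x -> delta (p x) = 0 ;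
  hodge_pdelta : forall x, C x -> p (delta x) = 0 ;
  hodge_homotopy : forall x, C x -> x = p x + d (delta x) + delta (d x) }.

Section Decomposition.
Variables (K : nzRingType) (M : lmodType K) (C : set M) (d delta p : M -> M).
Hypothesis HD : hodge_data C d delta p.
Implicit Types (x y : M) (t : K).
Let lin (f : M -> M) := forall t x y, C x -> C y -> f (t *: x + y) = t *: f x + f y.
Let C0 := hodge_C0 HD.
Let C_comb := hodge_comb HD.
Let Cd := hodge_Cd HD.
Let Cdelta := hodge_Cdelta HD.
Let Cp := hodge_Cp HD.
Let d_lin : lin d := hodge_d_lin HD.
Let delta_lin : lin delta := hodge_delta_lin HD.
Let p_lin : lin p := hodge_p_lin HD.
Let dd := hodge_dd HD.
Let deltadelta := hodge_deltadelta HD.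
Let dp := hodge_dp HD.
Let pd := hodge_pd HD.
Let deltap := hodge_deltap HD.
Let pdelta := hodge_pdelta HD.
Let homotopy := hodge_homotopy HD.

Let f0 f : lin f -> f 0 = 0.
Proof.
by move=> f_lin; have := f_lin (-1) _ _ C0 C0; rewrite scaler0 addr0 scaleN1r addNr.
Qed.

Let fD f : lin f -> forall x y, C x -> C y -> f (x + y) = f x + f y.
Proof.
by move=> f_lin x y Cx Cy; have := f_lin 1 _ _ Cx Cy; rewrite !scale1r.
Qed.

Let CD x y : C x -> C y -> C (x + y).
Proof. by move=> Cx Cy; rewrite -[x]scale1r; exact: C_comb. Qed.

Let CB x y : C x -> C y -> C (x - y).
Proof. by move=> Cx Cy; rewrite addrC -scaleN1r; exact: C_comb. Qed.

Let fB f : lin f -> forall x y, C x -> C y -> f (x - y) = f x - f y.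
Proof.
move=> f_lin x y Cx Cy.
by rewrite addrC -scaleN1r (f_lin (-1) _ _ Cy Cx) scaleN1r addrC.
Qed.

(** On each of the three images all terms but one of the homotopy vanish, so one
    of p, d delta and delta d is the identity there and the others are 0. *)
Lemma im_p a : (p @` C) a -> [/\ C a, p a = a, d a = 0 & delta a = 0].
Proof.
move=> [x Cx <-]; split; [exact: Cp| |exact: dp|exact: deltap].
by rewrite [RHS](homotopy (Cp Cx)) dp // deltap // (f0 d_lin) (f0 delta_lin) !addr0.
Qed.

Lemma im_d b : (d @` C) b -> [/\ C b, p b = 0, d b = 0 & d (delta b) = b].
Proof.
move=> [x Cx <-]; split; [exact: Cd|exact: pd|exact: dd|].
by rewrite [RHS](homotopy (Cd Cx)) pd // dd // (f0 delta_lin) add0r addr0.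
Qed.

Lemma im_delta c : (delta @` C) c ->
  [/\ C c, p c = 0, delta c = 0 & delta (d c) = c].
Proof.
move=> [x Cx <-]; split; [exact: Cdelta|exact: pdelta|exact: deltadelta|].
by rewrite [RHS](homotopy (Cdelta Cx)) pdelta // deltadelta // (f0 d_lin) !add0r.
Qed.

Let im0 f : lin f -> (f @` C) 0.
Proof. by move=> f_lin; exists 0 => //; exact: f0. Qed.

(** p and d delta project a sum onto its first and second terms. *)
Lemma decomposition_unique a b c a' b' c' :
  (p @` C) a -> (d @` C) b -> (delta @` C) c ->
  (p @` C) a' -> (d @` C) b' -> (delta @` C) c' ->
  a + b + c = a' + b' + c' -> [/\ a = a', b = b' & c = c'].
Proof.
have proj a1 b1 c1 : (p @` C) a1 -> (d @` C) b1 -> (delta @` C) c1 ->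
    p (a1 + b1 + c1) = a1 /\ d (delta (a1 + b1 + c1)) = b1.
  move=> /im_p[Ca pa _ da] /im_d[Cb pb _ db] /im_delta[Cc pc dc _].
  rewrite !(fD p_lin) ?(fD delta_lin) //; try by do ?apply: CD.
  by rewrite pa pb pc da dc !addr0 add0r.
move=> ia ib ic ia' ib' ic' e.
have [pa db] := proj _ _ _ ia ib ic; have [pa' db'] := proj _ _ _ ia' ib' ic'.
have ea : a = a' by rewrite -pa e pa'.
have eb : b = b' by rewrite -db e db'.
by split=> //; move: e; rewrite ea eb => /addrI.
Qed.

Lemma dsum_complex : dsum3 C (p @` C) (d @` C) (delta @` C).
Proof.
split; last exact: decomposition_unique.
apply/seteqP; split=> [x Cx|x [a [b [c [/im_p[Ca _ _ _] /im_d[Cb _ _ _] /im_delta[Cc _ _ _] ->]]]]].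
  exists (p x), (d (delta x)), (delta (d x)); split; last exact: homotopy.
  - by exists x.
  - by exists (delta x) => //; exact: Cdelta.
  - by exists (d x) => //; exact: Cd.
exact: CD (CD Ca Cb) Cc.
Qed.

Lemma dsum_ker_d : dsum2 (ker_on C d) (p @` C) (d @` C).
Proof.
split=> [|a b a' b' ia ib ia' ib' e]; last first.
  have z := im0 delta_lin.
  by have [] := decomposition_unique ia ib z ia' ib' z; rewrite ?e.
apply/seteqP; split=> [x [Cx dx]|x [a [b [/im_p[Ca _ da _] /im_d[Cb _ db _] ->]]]].
  exists (p x), (d (delta x)); split; [by exists x| |].
    by exists (delta x) => //; exact: Cdelta.
  by rewrite {1}(homotopy Cx) dx (f0 delta_lin) addr0.
by split; [exact: CD|rewrite (fD d_lin) // da db addr0].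
Qed.

Lemma dsum_ker_delta : dsum2 (ker_on C delta) (p @` C) (delta @` C).
Proof.
split=> [|a c a' c' ia ic ia' ic' e]; last first.
  have z := im0 d_lin.
  by have [] := decomposition_unique ia z ic ia' z ic'; rewrite ?addr0 ?e.
apply/seteqP; split=> [x [Cx dx]|x [a [b [/im_p[Ca _ _ da] /im_delta[Cb _ db _] ->]]]].
  exists (p x), (delta (d x)); split; [by exists x| |].
    by exists (d x) => //; exact: Cd.
  by rewrite {1}(homotopy Cx) dx (f0 d_lin) addr0.
by split; [exact: CD|rewrite (fD delta_lin) // da db addr0].
Qed.

Lemma harmonic_im_p : ker_on C d `&` ker_on C delta = p @` C.
Proof.
apply/seteqP; split=> [x [[Cx dx] [_ ex]]|x /im_p[Cx _ dx ex]].
  by exists x => //; rewrite [RHS](homotopy Cx) dx ex (f0 d_lin) (f0 delta_lin) !addr0.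
by split; split.
Qed.

Lemma dsum_ker_p : dsum2 (ker_on C p) (d @` C) (delta @` C).
Proof.
split=> [|b c b' c' ib ic ib' ic' e]; last first.
  have z := im0 p_lin.
  by have [] := decomposition_unique z ib ic z ib' ic'; rewrite ?add0r ?e.
apply/seteqP; split=> [x [Cx px]|x [b [c [/im_d[Cb pb _ _] /im_delta[Cc pc _ _] ->]]]].
  exists (d (delta x)), (delta (d x)); split.
  - by exists (delta x) => //; exact: Cdelta.
  - by exists (d x) => //; exact: Cd.
  - by rewrite {1}(homotopy Cx) px add0r.
by split; [exact: CD|rewrite (fD p_lin) // pb pc addr0].
Qed.

(** The choice of an element in the class is immaterial because p kills im d. *)
Definition harmonic_part (X : set M) : M := p (xget 0 X).

Lemma harmonic_part_coset x : C x ->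
  harmonic_part (coset_add (d @` C) x) = p x.
Proof.
move=> Cx; rewrite /harmonic_part.
have : coset_add (d @` C) x (xget 0 (coset_add (d @` C) x)).
  apply: xgetPex; exists x; exists 0; last by rewrite addr0.
  exact: im0.
move=> [b /im_d[Cb pb _ _] <-].
by rewrite (fD p_lin) // pb addr0.
Qed.

Lemma harmonic_part_bij :
  set_bij (quot (ker_on C d) (d @` C)) (p @` C) harmonic_part.
Proof.
split.
- by move=> _ [x [Cx _] <-]; rewrite harmonic_part_coset //; exists x.
- move=> X Y /set_mem[x [Cx dx] <-] /set_mem[y [Cy dy] <-].
  rewrite !harmonic_part_coset // => pxy.
  have xy : x - y = d (delta (x - y)).
    rewrite {1}(homotopy (CB Cx Cy)) (fB p_lin) // (fB d_lin) // pxy dx dy.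
    by rewrite !subrr (f0 delta_lin) add0r addr0.
  have bxy : (d @` C) (x - y).
    by rewrite xy; exists (delta (x - y)) => //; apply: Cdelta; exact: CB.
  have imB b b' : (d @` C) b -> (d @` C) b' -> (d @` C) (b + b').
    by move=> [u Cu <-] [v Cv <-]; exists (u + v); [exact: CD|exact: fD].
  have imN b : (d @` C) b -> (d @` C) (- b).
    move=> [u Cu <-]; exists (0 - u); first exact: CB.
    by rewrite (fB d_lin) // (f0 d_lin) sub0r.
  apply/seteqP; split=> _ [b ib <-].
    exists (x - y + b); first exact: imB.
    by rewrite addrA addrCA subrr addr0.
  exists (- (x - y) + b); first by apply: imB => //; exact: imN.
  by rewrite opprB addrA addrCA subrr addr0.
- move=> _ [x Cx <-]; exists (coset_add (d @` C) (p x)).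
    by exists (p x) => //; split; [exact: Cp|exact: dp].
  rewrite harmonic_part_coset; last exact: Cp.
  by have [] := im_p (a := p x) (ex_intro2 _ _ x Cx erefl).
Qed.

Lemma harmonic_part_linear t x y : C x -> C y ->
  harmonic_part (coset_add (d @` C) (t *: x + y)) =
  t *: harmonic_part (coset_add (d @` C) x) + harmonic_part (coset_add (d @` C) y).
Proof.
by move=> Cx Cy; rewrite !harmonic_part_coset ?p_lin //; exact: C_comb.
Qed.

End Decomposition.

(** * The Lie algebra relations on D_1 and the theorem *)

Section MainTheorem.
Variables (R : realType) (neg : bool).
Variables (V : completeNormedModType R[i]) (ip : V -> V -> R[i]) (U : 'M[R]_2 -> V -> V).
Hypothesis HD : is_D1 neg ip U.
Variables (phi : V -> R[i]) (h : V).
Hypothesis phi_linear : forall (a : R[i]) (u v : V), Cinf U u -> Cinf U v ->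
  phi (a *: u + v) = a * phi u + phi v.
Hypothesis phi_ker :
  [set v | Cinf U v /\ phi v = 0] = [set dU U (slE R) w | w in Cinf U].
Hypothesis phi_H : forall f : V, Cinf U f ->
  dual_dU U (slH R) phi f = - ((Num.sqrt 2)^-1)%:C * phi f.

Let Hip := D1_hilbert HD.
Let HU := D1_unitary HD.

(** The K-types of D_1 are the k with 1 <= \pm k. *)
Lemma isotypic0 : isotypic U 0 = [set 0].
Proof. by have := D1_types HD 0; rewrite mulr0. Qed.

(** The kernel of phi is the image of pi(E), so the choice made by [piEinv] is
    effective. *)
Lemma piEinvP v : Cinf U v -> phi v = 0 ->
  Cinf U (piEinv U v) /\ dU U (slE R) (piEinv U v) = v.
Proof.
move=> sv pv; have : [set v | Cinf U v /\ phi v = 0] v by [].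
rewrite phi_ker => -[w sw wv].
exact: (@xgetPex _ 0 [set w | Cinf U w /\ dU U (slE R) w = v] (ex_intro _ w (conj sw wv))).
Qed.

Lemma phi_dUE v : Cinf U v -> phi (dU U (slE R) v) = 0.
Proof.
move=> sv; have : [set v | Cinf U v /\ phi v = 0] (dU U (slE R) v).
  by rewrite phi_ker; exists v.
by case.
Qed.

Lemma phi_dUH v : Cinf U v -> phi (dU U (slH R) v) = ((Num.sqrt 2)^-1)%:C * phi v.
Proof. by move=> sv; apply: oppr_inj; rewrite -[LHS]/(dual_dU U _ phi v) phi_H // mulNr. Qed.

Lemma opSP v : Cinf U v -> Cinf U (opS U v) /\
  dU U (slE R) (opS U v) = dU U (slH R) v - ((Num.sqrt 2)^-1)%:C *: v.
Proof.
move=> sv; have sH := Cinf_dU Hip HU (one_param_slH R) sv; apply: piEinvP.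
  by apply: (CinfB HU) => //; exact: (CinfZ HU).
rewrite addrC -scaleNr phi_linear // phi_dUH //.
by rewrite mulNr addNr.
Qed.

Lemma opTP (h_Cinf : Cinf U h) (phi_h : phi h = 1) v : Cinf U v ->
  Cinf U (opT U phi h v) /\ dU U (slE R) (opT U phi h v) = v - phi v *: h.
Proof.
move=> sv; apply: piEinvP.
  by apply: (CinfB HU) => //; exact: (CinfZ HU).
by rewrite addrC -scaleNr phi_linear // phi_h mulr1 addNr.
Qed.

End MainTheorem.

Theorem theorem84 (R : realType) (neg : bool)
    (V : completeNormedModType R[i]) (ip : V -> V -> R[i])
    (U : 'M[R]_2 -> V -> V) (HD : is_D1 neg ip U)
    (phi : V -> R[i])
    (phi_linear : forall (a : R[i]) (u v : V), Cinf U u -> Cinf U v ->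
       phi (a *: u + v) = a * phi u + phi v)
    (phi_ker : [set v | Cinf U v /\ phi v = 0] = [set dU U (slE R) w | w in Cinf U])
    (phi_H : forall f : V, Cinf U f ->
       dual_dU U (slH R) phi f = - ((Num.sqrt 2)^-1)%:C * phi f)
    (h : V) (h_Cinf : Cinf U h) (h_type : isotypic U (sgz_of neg) h)
    (phi_h : phi h = 1) :
  let C := complex_an U in
  let d := dan U in
  let delta := delta_op U phi h in
  let p := p_op neg phi h in
  let im (f : tcochain V -> tcochain V) := f @` C in
  [/\ dsum3 C (im p) (im d) (im delta),
      dsum2 (ker_on C d) (im p) (im d),
      dsum2 (ker_on C delta) (im p) (im delta),
      ker_on C d `&` ker_on C delta = im p &
      dsum2 (ker_on C p) (im d) (im delta)]
  /\ (forall x, C x ->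
        x = p x + d (delta x) + delta (d x)
        /\ [/\ im p (p x), im d (d (delta x)) & im delta (delta (d x))])
  /\ quot_iso (ker_on C d) (im d) (im p).
Proof.
have Hip := D1_hilbert HD; have HU := D1_unitary HD.
have oE := one_param_slE R; have oH := one_param_slH R.
have k2 : sgz_of neg * sgz_of neg = 1.
  by rewrite /sgz_of -expr2 -exprM mulnC exprM sqrrN expr1n.
move=> C d delta p im.
have low := dU_lowest Hip HU k2 h_Cinf h_type (isotypic0 HD).
set kap := (0 +i* _)%C in low.
have kk : kap * kap = - 2.
  apply/eqP; rewrite eq_complex /=; apply/andP; split; apply/eqP.
    rewrite mul0r sub0r mulrACA -intrM k2 mul1r -expr2 sqr_sqrtr ?ler0n //.
  by rewrite mul0r mulr0 addr0 ?oppr0.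
have SP := opSP HD phi_linear phi_ker phi_H.
have TP := opTP HD phi_linear phi_ker h_Cinf phi_h.
have Han : an_splitting (Cinf U) (dU U (slH R)) (dU U (slE R)) (opS U) (opT U phi h)
    phi h kap.
  split=> //.
  - exact: (Cinf0 HU).
  - exact: (Cinf_comb HU).
  - by move=> v; exact: (Cinf_dU Hip HU oH).
  - by move=> v; exact: (Cinf_dU Hip HU oE).
  - by move=> a u v; exact: (dU_comb HU a oH).
  - by move=> a u v; exact: (dU_comb HU a oE).
  - by move=> v; exact: (dU_slE_inj Hip HU (isotypic0 HD)).
  - exact: (dU_bracket Hip HU).
  - exact: (phi_dUE phi_ker).
  - exact: (phi_dUH phi_H).
  - by move=> v /SP[].
  - by move=> v /TP[].
  - by move=> v /SP[].
  - by move=> v /TP[].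
have dE : coordinates d (dC (dU U (slH R)) (dU U (slE R))) by exact: dan_coord.
have deltaE : coordinates delta (deltaC (opS U) (opT U phi h)) by exact: delta_coord.
have pE : coordinates p (pC phi h kap) by move=> *; exact: p_coord.
have C0 : C 0 by move=> A j; rewrite !ffunE; exact: (Cinf0 HU).
have C_comb (a : R[i]) x y : C x -> C y -> C (a *: x + y).
  by move=> Cx Cy A j; rewrite !ffunE; apply: (Cinf_comb HU); [exact: Cx|exact: Cy].
have Cd x : C x -> C (d x) by exact: (d_in_C Han dE).
have Cdelta x : C x -> C (delta x) by exact: (delta_in_C Han deltaE).
have Cp x : C x -> C (p x) by exact: (p_in_C Han pE).
have d_l := d_lin Hip Han dE; have delta_l := delta_lin Hip Han deltaE.
have p_l := p_lin Hip Han pE.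
have dd := d_d Hip Han dE; have ee := delta_delta Hip Han deltaE.
have dp := d_p Hip Han dE pE; have pd := p_d Han dE pE.
have ep := delta_p Hip Han deltaE pE; have pe := p_delta Han deltaE pE.
have hom := homotopy Hip Han dE deltaE pE.
have hodge : hodge_data C d delta p.
  exact: (HodgeData C0 C_comb Cd Cdelta Cp d_l delta_l p_l dd ee dp pd ep pe hom).
split; [|split].
- split.
  + exact: dsum_complex hodge.
  + exact: dsum_ker_d hodge.
  + exact: dsum_ker_delta hodge.
  + exact: harmonic_im_p hodge.
  + exact: dsum_ker_p hodge.
- move=> x Cx; split; first exact: hom.
  by split; [exists x|exists (delta x) => //; exact: Cdelta|exists (d x) => //; exact: Cd].
- exists (harmonic_part p); split.
  + exact: harmonic_part_bij hodge.
  + by move=> a x y [Cx _] [Cy _]; exact: (harmonic_part_linear hodge).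
  + move=> n x [Cx _] nx; rewrite (harmonic_part_coset hodge) //.
    exact: (p_homog Han pE).
Qed.
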